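(* Let $p \ge 3$. Then $q = 4$ is the minimal value of $q > 0$ for which there exists a constant $C(p,q) > 0$ (depending only on $p$ and $q$) such that the inequality $$\mathbb{E}\left|\sum_{i=1}^n a_i \varepsilon_i\right|^p \le \mathbb{E}|G|^p - C(p,q) \sum_{i=1}^n a_i^q$$ holds for every integer $n \ge 1$ and all real numbers $a_1 \ge \ldots \ge a_n \ge 0$ with $\sum_{i=1}^n a_i^2 = 1$, where $\varepsilon_1, \ldots, \varepsilon_n$ are i.i.d. Rademacher random variables and $G$ is a standard Gaussian random variable.
   Context: A Rademacher random variable $\varepsilon$ satisfies $\mathbb{P}(\varepsilon = 1) = \mathbb{P}(\varepsilon = -1) = \frac12$. *)

(* Defs.v *)
From HB Require Import structures.
From mathcomp Require Import all_boot all_order all_algebra.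
From mathcomp Require Import all_classical all_reals all_analysis.

Set Implicit Arguments.
Unset Strict Implicit.
Unset Printing Implicit Defensive.

Import Order.TTheory GRing.Theory Num.Theory.
Import numFieldNormedType.Exports.

Local Open Scope classical_set_scope.
Local Open Scope ring_scope.

Section random_variables.
Context (d : measure_display) (T : measurableType d) (R : realType).
Variable P : probability T R.

Definition rademacher (X : {RV P >-> R}) : Prop :=
  P (X @^-1` [set 1]) = (2^-1 : R)%:E /\ P (X @^-1` [set -1]) = (2^-1 : R)%:E.

Definition standard_gaussian (X : {RV P >-> R}) : Prop :=
  forall A : set R, measurable A -> distribution P X A = normal_prob 0 1 A.

Definition mutually_independent (I : finType) (X : I -> {RV P >-> R}) : Prop :=
  forall (J : {set I}) (A : I -> set R),
    (forall i, measurable (A i)) ->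
    P (\bigcap_(i in [set` J]) (X i @^-1` A i)) =
    (\prod_(i in J) P (X i @^-1` A i))%E.

Definition iid_rademacher (I : finType) (X : I -> {RV P >-> R}) : Prop :=
  mutually_independent X /\ forall i, rademacher (X i).

End random_variables.

(* The constant C is chosen before n, the coefficients and the probability
   space, so that it depends on p and q only.  No joint law of the signs and G
   is prescribed, as only E|G|^p enters.  Since q is a positive real, [`^]
   evaluates to 0 at vanishing coefficients. *)
Definition khinchine_deficit (R : realType) (p q : R) : Prop :=
  exists2 C : R, 0 < C &
  forall (n : nat) (a : 'I_n -> R), (1 <= n)%N ->
    (forall i j : 'I_n, (i <= j)%N -> a j <= a i) ->
    (forall i, 0 <= a i) ->
    \sum_(i < n) a i ^+ 2 = 1 ->
  forall (d : measure_display) (T : measurableType d) (P : probability T R)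
    (eps : 'I_n -> {RV P >-> R}) (G : {RV P >-> R}),
    iid_rademacher eps -> standard_gaussian G ->
    ('E_P[(fun w => (`|\sum_(i < n) a i * eps i w| `^ p)%R)] <=
     'E_P[(fun w => (`|G w| `^ p)%R)] - (C * \sum_(i < n) a i `^ q)%R%:E)%E.

(* Main.v *)
(* Write f(x) = |x|^p and replace the signs by Gaussians one at a time.  Since
   f'' is convex for p >= 3, (f(z + s) + f(z - s)) / 2 lies above its tangent
   parabola in s^2, so by Jensen each replacement a eps -> a g increases the
   expectation.  The gain is at least k a^4 as soon as the rest of the sum has a
   Gaussian part of variance at least 1/4, because that part visits the region
   where the parabola inequality is strict: |z| <= a / 2 if p = 3, z in [5, 6] if
   p > 3.  To have such a part for every coefficient, each a eps is first split,
   again by the parabola inequality, into a (eps1 + eps2) / sqrt 2, and all the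
   eps2 are replaced before the eps1.

   Conversely, expanding the Gaussian density to second order shows that the
   replacement increases the expectation by O(a^4 / t^2) if t is the variance of
   the Gaussian part.  With n coefficients of size (2 n)^(-1/2) and n^5 of size
   (2 n^5)^(-1/2) the total deficit is O(1 / n), whereas the n large coefficients
   contribute to sum a_i^q a quantity of order n^(1 - q/2): hence q >= 4. *)
From HB Require Import structures.
Require Import Defs.
From mathcomp Require Import all_boot all_order all_algebra.
From mathcomp Require Import all_classical all_reals all_analysis.
From mathcomp Require Import measurable_realfun.
From mathcomp Require Import ring lra.
Import Order.TTheory GRing.Theory Num.Theory.
Import numFieldNormedType.Exports.
Set Implicit Arguments.
Unset Strict Implicit.
Unset Printing Implicit Defensive.
Local Open Scope classical_set_scope.
Local Open Scope ring_scope.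

(** * Convexity of the even power functions *)

(** The obstacle to a gain of order a^4 is that the first signs to be replaced have no Gaussian part
    behind them: for p = 3 the other signs may never bring the sum within a / 2 of 0. The splitting
    supplies a Gaussian part of variance 1/2 before any gain is counted, and costs only a factor 4
    on the fourth powers. The signs not yet replaced might still carry the sum far away; by
    Chebyshev they stay in [-2, 2] with probability at least 3/4, and only that event is used. The
    gain is a height times the length of a window that the Gaussian part hits with probability
    proportional to the length: b^3 times b if p = 3, b^4 times 1 if p > 3. The tangent parabola
    itself contributes nothing on average, because a sign and a Gaussian have the same second
    moment. In the converse the expansion needs a positive variance from the start. A Gaussian of
    variance n^-2 is therefore inserted, and removed by convexity at a cost O(1 / n). The exponent 5
    makes the small swaps cheap enough: n^5 terms of order (n^-5)^2 / (n^-2)^2 add up to order 1 /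
    n. *)

Section calculus.
Context {R : realType}.
Implicit Types (x y z s a r p e : R).

Lemma derive_ge0_le (F dF : R -> R) a b : a <= b ->
  (forall x, a <= x <= b -> is_derive x 1 F (dF x)) ->
  (forall x, a <= x <= b -> 0 <= dF x) -> F a <= F b.
Proof.
move=> ab dFE dF0.
have dF1 x : x \in `]a, b[ -> is_derive x 1 F (dF x).
  by move=> xab; apply: dFE; rewrite !(itvP xab).
have cF : {within `[a, b], continuous F}.
  apply: derivable_within_continuous => x xab.
  by apply: (@ex_derive _ _ _ _ _ _ _ (dFE x _)); rewrite !(itvP xab).
have [c cab E] := MVT_segment ab dF1 cF.
rewrite -subr_ge0 E mulr_ge0 ?subr_ge0//; apply: dF0.
by rewrite !(itvP cab).
Qed.

(** Signed powers carry the derivatives of |x|^p through the origin: elsewhere they are locally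
    ordinary powers, and at 0 the difference quotient is |h|^r, which tends to 0 because [r > 0]. *)
Lemma is_derive_signed_powR r x : 0 < r ->
  is_derive x 1 (fun y => y * `|y| `^ r) ((r + 1) * `|x| `^ r).
Proof.
move=> r0; have [x0|x0|->] := ltgtP x 0.
- apply: (@near_eq_is_derive _ _ _ (fun y => - ((- y) `^ (r + 1)))).
  + near=> y.
    have y0 : y < 0 by near: y; exact: lt_nbhsl.
    rewrite ltr0_norm// powRD ?powRr1//; first by ring.
      by rewrite oppr_ge0 ltW.
    by apply/implyP => _; rewrite oppr_eq0 lt_eqF.
  + have h : is_derive (- x) 1 (@powR R ^~ (r + 1)) ((r + 1) * (- x) `^ (r + 1 - 1)).
      by apply: is_derive1_powR; rewrite oppr_gt0.
    have h2 := @is_derive1_comp R (@powR R ^~ (r + 1)) -%R x _ _ h (is_deriveNid x 1).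
    have h3 : is_derive x 1 (fun y => - ((- y) `^ (r + 1))) _ := is_deriveN h2.
    apply: is_derive_eq h3 _.
    by rewrite addrK ltr0_norm//; ring.
- apply: (@near_eq_is_derive _ _ _ (fun y => y `^ (r + 1))).
  + near=> y.
    have y0 : 0 < y by near: y; exact: lt_nbhsr.
    rewrite gtr0_norm// powRD ?powRr1//; first by ring.
      exact: ltW.
    by apply/implyP => _; rewrite gt_eqF.
  + have h := @is_derive1_powR R (r + 1) x x0.
    apply: is_derive_eq h _.
    by rewrite addrK gtr0_norm.
- rewrite normr0 powR0 ?gt_eqF// mulr0.
  have cv : h^-1 *: ((h *: (1:R) + 0) * `|h *: (1:R) + 0| `^ r - 0 * `|0:R| `^ r)
     @[h --> (0:R)^'] --> (0 : R).
    apply: (@cvg_trans _ (`|h| `^ r @[h --> (0:R)^'])).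
      apply: near_eq_cvg; near=> h.
      have h0 : h != 0 by near: h; exact: nbhs_dnbhs_neq.
      by rewrite mul0r subr0 addr0 /GRing.scale/= mulr1 mulrA mulVf// mul1r.
    apply/cvgrPdist_lt => /= e e0.
    near=> h.
    have h0 : h != 0 by near: h; exact: nbhs_dnbhs_neq.
    rewrite sub0r normrN ger0_norm ?powR_ge0//.
    have he : `|h| < e `^ r^-1.
      near: h; apply: dnbhs0_lt; exact: powR_gt0.
    rewrite -[ltRHS]powRr1 ?ltW// -(mulVf (x := r)) ?gt_eqF// powRrM.
    by apply: gt0_ltr_powR => //; rewrite ?nnegrE ?powR_ge0 //.
  apply: DeriveDef; last exact: (cvg_lim _ cv).
  by apply/cvg_ex; exists 0; exact: cv.
Unshelve. all: by end_near. Qed.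

Lemma is_derive_norm_powR p x : 2 < p ->
  is_derive x 1 (fun y => `|y| `^ p) (p * (x * `|x| `^ (p - 2))).
Proof.
move=> p2.
have pE (y : R) : `|y| `^ p = y * (y * `|y| `^ (p - 2)).
  have [->|y0] := eqVneq y 0; first by rewrite normr0 powR0 ?gt_eqF ?mul0r//; lra.
  rewrite mulrA -expr2 -real_normK ?num_real// -powR_mulrn// -powRD.
    by congr (_ `^ _); lra.
  by apply/implyP; rewrite normr_eq0.
have h := @is_deriveM R R^o id (fun y => y * `|y| `^ (p - 2)) x 1 _ _
  (is_derive_id _ _) (is_derive_signed_powR x (_ : 0 < p - 2)).
rewrite (_ : (fun y => _) = (fun y : R => y * (y * `|y| `^ (p - 2)))); last first.
  by apply/funext => y; exact: pE.
apply: is_derive_eq; first by apply: h; lra.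
by rewrite /GRing.scale/= mulr1; ring.
Qed.

Lemma is_derive_comp_addl (f : R -> R) df z s :
  is_derive (z + s) 1 f df -> is_derive s 1 (fun x => f (z + x)) df.
Proof.
move=> h.
have hg : is_derive s 1 (fun x : R => z + x) (0 + 1).
  exact: (is_deriveD (is_derive_cst z s 1) (is_derive_id s 1)).
have hfg : is_derive s 1 (fun x => f (z + x)) _ := is_derive1_comp h hg.
apply: is_derive_eq hfg _.
by rewrite add0r mulr1.
Qed.

Lemma is_derive_comp_subl (f : R -> R) df z s :
  is_derive (z - s) 1 f df -> is_derive s 1 (fun x => f (z - x)) (- df).
Proof.
move=> h.
have hg : is_derive s 1 (fun x : R => z - x) (0 - 1).
  exact: (is_deriveB (is_derive_cst z s 1) (is_derive_id s 1)).
have hfg : is_derive s 1 (fun x => f (z - x)) _ :=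
  @is_derive1_comp R f (fun x => z - x) s _ _ h hg.
apply: is_derive_eq hfg _.
by rewrite sub0r mulrN1.
Qed.

(* [W'] is convex with value 0 at 0, so [W'(s) / s] is nondecreasing: [W] lies
   above the parabola in [s ^+ 2] tangent to it at [a]. *)
Lemma tangent_parabola_le (W V Y : R -> R) S a s :
  (forall x, is_derive x 1 W (V x)) ->
  (forall x, 0 <= x <= S -> is_derive x 1 V (Y x)) -> V 0 = 0 ->
  (forall x y, 0 <= x -> x <= y -> y <= S -> Y x <= Y y) ->
  0 < a <= S -> 0 <= s <= S ->
  W a + V a / (2 * a) * (s ^+ 2 - a ^+ 2) <= W s.
Proof.
move=> dW dV V0 ndY /andP[a0 aS] /andP[s0 sS].
(* Monotonicity of [V x / x], cross-multiplied so that [x = 0] is allowed: the mean slopes of [V] on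
   [0, x] and [x, y] are values of [Y] at ordered points. *)
have ratio x y : 0 <= x -> x <= y -> y <= S -> V x * y <= V y * x.
  move=> x0 xy yS.
  have mvt u v : 0 <= u -> u <= v -> v <= S ->
      exists2 c, u <= c <= v & V v - V u = Y c * (v - u).
    move=> u0 uv vS.
    have dV1 t : t \in `]u, v[ -> is_derive t 1 V (Y t).
      by move=> tuv; apply: dV; rewrite (le_trans u0) ?(le_trans _ vS) ?(itvP tuv).
    have cV : {within `[u, v], continuous V}.
      apply: derivable_within_continuous => t tuv.
      apply: (@ex_derive _ _ _ _ _ _ _ (dV t _)).
      by rewrite (le_trans u0) ?(le_trans _ vS) ?(itvP tuv).
    have [c cuv E] := MVT_segment uv dV1 cV.
    by exists c; rewrite ?(itvP cuv).
  have [c1 /andP[c10 c1x]] := mvt 0 x (lexx _) x0 (le_trans xy yS).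
  have [c2 /andP[xc2 c2y]] := mvt x y x0 xy yS.
  rewrite V0 !subr0 => E2 E1.
  have Yle : Y c1 <= Y c2 by apply: ndY => //; [exact: le_trans xc2|exact: le_trans yS].
  have -> : V y = Y c1 * x + Y c2 * (y - x) by rewrite -E1 -E2; ring.
  rewrite E1 -subr_ge0.
  have -> : (Y c1 * x + Y c2 * (y - x)) * x - Y c1 * x * y =
    (Y c2 - Y c1) * (y - x) * x by ring.
  by rewrite !mulr_ge0// subr_ge0.
set m := V a / (2 * a).
(* [phi] is minimal at [a], since for x > 0 its derivative has the sign of [V x / x - V a / a]. *)
pose phi x := W x - m * x ^+ 2.
have dphi x : is_derive x 1 phi (V x - V a / a * x).
  have h : is_derive x 1 phi _ :=
    is_deriveB (dW x) (is_deriveZ m (is_deriveX 2 (is_derive_id x (1:R)))).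
  apply: is_derive_eq h _.
  rewrite /GRing.scale/= /m expr1; field.
  by rewrite gt_eqF.
have sgn_dphi x : V x - V a / a * x = (V x * a - V a * x) / a.
  by field; rewrite gt_eqF.
suff : phi a <= phi s by rewrite /phi mulrBr; lra.
have [as_|sa] := leP a s.
  apply: (derive_ge0_le as_ (fun x _ => dphi x)) => x /andP[ax xs].
  rewrite sgn_dphi divr_ge0 ?(ltW a0)// subr_ge0.
  by apply: ratio => //; [exact: ltW|exact: le_trans sS].
rewrite -lerN2.
apply: (@derive_ge0_le (- phi) (fun x => - (V x - V a / a * x)) _ _ (ltW sa)) => x.
move=> /andP[sx xa]; rewrite sgn_dphi oppr_ge0 ler_pdivrMr// mul0r subr_le0.
by apply: ratio => //; exact: le_trans sx.
Qed.

Lemma norm_powR_convex r l x y : 1 <= r -> 0 <= l <= 1 ->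
  `|l * x + (1 - l) * y| `^ r <= l * `|x| `^ r + (1 - l) * `|y| `^ r.
Proof.
move=> r1 l01; have /andP[l0 l1] := l01.
apply: (@le_trans _ _ ((l * `|x| + (1 - l) * `|y|) `^ r)).
  apply: ge0_ler_powR; rewrite ?nnegrE//; first lra.
    by rewrite addr_ge0// mulr_ge0// subr_ge0.
  have l1' : 0 <= 1 - l by rewrite subr_ge0.
  by apply: (le_trans (ler_normD _ _)); rewrite !normrM (ger0_norm l0) (ger0_norm l1').
by apply: (convex_powR r1 (Itv01 l0 l1)); rewrite /= ?inE/= ?in_itv/= ?andbT.
Qed.

(** [z + x] and [z - x] are mixtures of [z + y] and [z - y] with the weights [l] and [1 - l]
    interchanged, so the two convexity bounds add up. *)
Lemma norm_powR_symm_ndecr r z x y : 1 <= r -> 0 <= x -> x <= y ->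
  `|z + x| `^ r + `|z - x| `^ r <= `|z + y| `^ r + `|z - y| `^ r.
Proof.
move=> r1 x0 xy; have [y0|y0] := leP y 0.
  by have -> : x = y by lra.
pose l := (y + x) / (2 * y).
have l01 : 0 <= l <= 1.
  by rewrite /l divr_ge0 ?ler_pdivrMr/= ?mul1r; lra.
have h1 := norm_powR_convex (z + y) (z - y) r1 l01.
have h2 := norm_powR_convex (z - y) (z + y) r1 l01.
have E1 : l * (z + y) + (1 - l) * (z - y) = z + x.
  by rewrite /l; field; rewrite gt_eqF.
have E2 : l * (z - y) + (1 - l) * (z + y) = z - x.
  by rewrite /l; field; rewrite gt_eqF.
by rewrite E1 in h1; rewrite E2 in h2; lra.
Qed.
(** Logarithms treat small and large [e] alike: ln x - ln y >= (x - y) / 9 and y^e >= 1. The bound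
    serves with [e = p - 3] at the points z - t and z + t for z in [5, 6] and t in [0, 3], which lie
    in [1, 9]. *)
Lemma powR_sub_ge e x y : 0 < e -> 1 <= y <= x -> x <= 9 ->
  e * (x - y) / 9 <= x `^ e - y `^ e.
Proof.
move=> e0 /andP[y1 yx] x9; have x0 : 0 < x by lra. have y0 : 0 < y by lra.
have lny0 : 0 <= ln y by exact: ln_ge0.
have hln : (x - y) / 9 <= ln x - ln y.
  have h : ln (y / x) <= y / x - 1.
    have -> : y / x = 1 + (y / x - 1) by ring.
    apply: (le_trans (le_ln1Dx _)); last by rewrite addrAC subrr add0r.
    by rewrite ltrBrDl subrr divr_gt0.
  rewrite ln_div// in h.
  apply: (@le_trans _ _ (1 - y / x)); last by lra.
  have -> : 1 - y / x = (x - y) / x by field; rewrite gt_eqF.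
  by rewrite ler_wpM2l ?subr_ge0// lef_pV2 ?posrE//; lra.
rewrite /powR !gt_eqF//.
have -> : e * ln x = e * ln y + (e * (ln x - ln y)) by ring.
rewrite expRD.
have h1 : 1 <= expR (e * ln y).
  by rewrite -expR0 ler_expR mulr_ge0// ltW.
have h2 := expR_ge1Dx (e * (ln x - ln y)).
have h3 : e * (x - y) / 9 <= e * (ln x - ln y).
  by rewrite -mulrA ler_wpM2l// ltW.
have h4 : 0 <= e * (ln x - ln y) by apply: le_trans h3; rewrite -mulrA mulr_ge0 ?(ltW e0)//; lra.
by nra.
Qed.

End calculus.

(** * Symmetric second differences of |x|^p and their gap above the tangent parabola *)

Section gap.
Context {R : realType} (p : R).
Hypothesis p_ge3 : 3 <= p.
Implicit Types (z s a b x y t e : R).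

Definition symm_sum z s : R := `|z + s| `^ p + `|z - s| `^ p.

(** The derivative of [symm_sum z] at [a] with respect to the variable s^2. *)
Definition tangent_slope z a : R :=
  p * ((z + a) * `|z + a| `^ (p - 2) - (z - a) * `|z - a| `^ (p - 2)) / (2 * a).

Definition dsymm_sum z s : R :=
  p * ((z + s) * `|z + s| `^ (p - 2) - (z - s) * `|z - s| `^ (p - 2)).

Definition d2symm_sum z s : R :=
  p * (p - 1) * (`|z + s| `^ (p - 2) + `|z - s| `^ (p - 2)).

Lemma is_derive_symm_sum z s : is_derive s 1 (symm_sum z) (dsymm_sum z s).
Proof.
have p3 := p_ge3.
have p2 : 2 < p by lra.
have h : is_derive s 1 (symm_sum z) _ := is_deriveD
  (is_derive_comp_addl (is_derive_norm_powR (z + s) p2))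
  (is_derive_comp_subl (is_derive_norm_powR (z - s) p2)).
by apply: is_derive_eq h _; rewrite /dsymm_sum; ring.
Qed.

Lemma is_derive_dsymm_sum z s : is_derive s 1 (dsymm_sum z) (d2symm_sum z s).
Proof.
have p3 := p_ge3.
have p2 : 0 < p - 2 by lra.
have h : is_derive s 1 (dsymm_sum z) _ := is_deriveZ p (is_deriveB
  (is_derive_comp_addl (is_derive_signed_powR (z + s) p2))
  (is_derive_comp_subl (is_derive_signed_powR (z - s) p2))).
by apply: is_derive_eq h _; rewrite /d2symm_sum /GRing.scale/=; ring.
Qed.

Lemma dsymm_sum0 z : dsymm_sum z 0 = 0.
Proof. by rewrite /dsymm_sum addr0 subr0 subrr mulr0. Qed.

(** Here [3 <= p] enters: the exponent [p - 2] is at least 1, so the second derivative of |x|^p is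
    convex. *)
Lemma d2symm_sum_ndecr z x y : 0 <= x -> x <= y -> d2symm_sum z x <= d2symm_sum z y.
Proof.
have p3 := p_ge3.
move=> x0 xy; rewrite /d2symm_sum ler_wpM2l//; first by rewrite mulr_ge0//; lra.
by apply: norm_powR_symm_ndecr => //; lra.
Qed.

Lemma symm_sumN z s : symm_sum z (- s) = symm_sum z s.
Proof. by rewrite /symm_sum opprK addrC. Qed.

(** The sign of the slope lets [smooth_gap] integrate the quadratic term as a nonnegative
    function. *)
Lemma tangent_slope_ge0 z a : 0 < a -> 0 <= tangent_slope z a.
Proof.
have p3 := p_ge3.
move=> a0; rewrite /tangent_slope -/(dsymm_sum z a) divr_ge0//; last lra.
rewrite -(dsymm_sum0 z).
apply: (@derive_ge0_le _ _ (d2symm_sum z) _ _ (ltW a0)) => [x _|x _].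
  exact: is_derive_dsymm_sum.
have h : 0 <= `|z + x| `^ (p - 2) + `|z - x| `^ (p - 2).
  by rewrite addr_ge0 ?powR_ge0.
by rewrite /d2symm_sum !mulr_ge0//; lra.
Qed.

Lemma symm_sum_tangent_le z a s : 0 < a ->
  symm_sum z a + tangent_slope z a * (s ^+ 2 - a ^+ 2) <= symm_sum z s.
Proof.
have p3 := p_ge3.
move=> a0.
wlog s0 : s / 0 <= s.
  move=> H; have [|s0] := leP 0 s; first exact: H.
  by rewrite -(symm_sumN z s) -(sqrrN s); apply: H; lra.
have nd (x y : R) : 0 <= x -> x <= y -> y <= Num.max a s ->
    d2symm_sum z x <= d2symm_sum z y.
  by move=> x0 xy _; exact: d2symm_sum_ndecr.
have h := @tangent_parabola_le R (symm_sum z) (dsymm_sum z) (d2symm_sum z) (Num.max a s) a s (is_derive_symm_sum z)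
  (fun (x : R) _ => is_derive_dsymm_sum z x) (dsymm_sum0 z) nd.
by apply: h; rewrite ?a0 ?s0 le_max lexx ?orbT.
Qed.

(** The tangent parabola bound is applied after subtracting k s^4; as s^4 exceeds its own tangent in
    s^2 by (s^2 - b^2)^2, this leaves the extra term. The second derivative [Y] stays nondecreasing
    because its derivative is at least p (p - 1) (p - 2) (p - 3) 2 s / 9 - 24 k s = 0, whence 108 =
    9 * 24 / 2. *)
Lemma symm_sum_gap_gt3 z b s : 3 < p -> 5 <= z <= 6 -> 0 < b <= 3 -> 0 <= s <= 3 ->
  symm_sum z b + tangent_slope z b * (s ^+ 2 - b ^+ 2) +
    p * (p - 1) * (p - 2) * (p - 3) / 108 * (s ^+ 2 - b ^+ 2) ^+ 2 <= symm_sum z s.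
Proof.
have p3 := p_ge3.
move=> p3' /andP[z5 z6] b03 s03; have /andP[b0 b3] := b03.
set k := p * (p - 1) * (p - 2) * (p - 3) / 108.
have k0 : 0 < k by rewrite divr_gt0// !mulr_gt0//; lra.
pose W s := symm_sum z s - k * s ^+ 4.
pose V s := dsymm_sum z s - 4 * k * s ^+ 3.
pose Y s := d2symm_sum z s - 12 * k * s ^+ 2.
have dW (x : R) : is_derive x 1 W (V x).
  have h : is_derive x 1 W _ := is_deriveB (is_derive_symm_sum z x)
    (is_deriveZ k (is_deriveX 4 (is_derive_id x (1 : R)))).
  by apply: is_derive_eq h _; rewrite /V /GRing.scale/=; ring.
have dV (x : R) : is_derive x 1 V (Y x).
  have h : is_derive x 1 V _ := is_deriveB (is_derive_dsymm_sum z x)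
    (is_deriveZ (4 * k) (is_deriveX 3 (is_derive_id x (1 : R)))).
  by apply: is_derive_eq h _; rewrite /Y /GRing.scale/=; ring.
have ndY (x y : R) : 0 <= x -> x <= y -> y <= 3 -> Y x <= Y y.
  move=> x0 xy y3.
  pose Y' s := p * (p - 1) * ((z + s) `^ (p - 2) + (z - s) `^ (p - 2)) - 12 * k * s ^+ 2.
  have YE (t : R) : 0 <= t <= 3 -> Y t = Y' t.
    by move=> t03; rewrite /Y /Y' /d2symm_sum !ger0_norm//; lra.
  rewrite !YE ?x0 ?(le_trans x0 xy) ?(le_trans xy y3)//.
  pose dY' s := p * (p - 1) * (p - 2) * ((z + s) `^ (p - 3) - (z - s) `^ (p - 3)) - 24 * k * s.
  apply: (@derive_ge0_le R Y' dY' x y xy) => t /andP[xt ty].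
    have zt : 0 < z + t by lra. have zt' : 0 < z - t by lra.
    have h : is_derive t 1 Y' _ := is_deriveB (is_deriveZ (p * (p - 1)) (is_deriveD
      (is_derive_comp_addl (is_derive1_powR (p - 2) zt))
      (is_derive_comp_subl (is_derive1_powR (p - 2) zt'))))
      (is_deriveZ (12 * k) (is_deriveX 2 (is_derive_id t (1 : R)))).
    apply: is_derive_eq h _; rewrite /dY' /GRing.scale/=.
    have -> : p - 2 - 1 = p - 3 by ring.
    by ring.
  rewrite /dY' subr_ge0.
  have h : (p - 3) * ((z + t) - (z - t)) / 9 <= (z + t) `^ (p - 3) - (z - t) `^ (p - 3).
    by apply: powR_sub_ge; lra.
  apply: (@le_trans _ _ (p * (p - 1) * (p - 2) * ((p - 3) * ((z + t) - (z - t)) / 9))).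
    by rewrite /k le_eqVlt; apply/orP; left; apply/eqP; field.
  by rewrite ler_wpM2l// !mulr_ge0//; lra.
have V0 : V 0 = 0 by rewrite /V dsymm_sum0 expr0n/= mulr0 subrr.
have := @tangent_parabola_le R W V Y 3 b s dW (fun x _ => dV x) V0 ndY.
rewrite b0 b3 s03 => /(_ isT isT); rewrite /W.
have -> : V b / (2 * b) = tangent_slope z b - 2 * k * b ^+ 2.
  by rewrite /V /tangent_slope -/(dsymm_sum z b); field; rewrite gt_eqF.
move=> h.
have -> : symm_sum z b + tangent_slope z b * (s ^+ 2 - b ^+ 2) + k * (s ^+ 2 - b ^+ 2) ^+ 2
  = (symm_sum z b - k * b ^+ 4 + (tangent_slope z b - 2 * k * b ^+ 2) * (s ^+ 2 - b ^+ 2)) + k * s ^+ 4 by ring.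
by rewrite -lerBrDr.
Qed.

(** For |z| below both [b] and [s] the symmetric sums are cubic polynomials, and the gap above the
    tangent parabola factors as (s - b)^2 (2 s + b - 3 z^2 / b). The first factor is at least b^2,
    the second at least b. *)
Lemma symm_sum_gap_eq3 z b s : p = 3 -> 0 < b -> - b / 2 <= z <= b / 2 -> 2 * b <= s ->
  symm_sum z b + tangent_slope z b * (s ^+ 2 - b ^+ 2) + b ^+ 3 <= symm_sum z s.
Proof.
have p3 := p_ge3.
move=> pE b0 /andP[zl zu] sb.
have -> : symm_sum z b = (b + z) ^+ 3 + (b - z) ^+ 3.
  have e1 : `|z + b| = b + z by rewrite ger0_norm; lra.
  have e2 : `|z - b| = b - z by rewrite ler0_norm; lra.
  by rewrite /symm_sum e1 e2 pE !powR_mulrn//; lra.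
have -> : symm_sum z s = (s + z) ^+ 3 + (s - z) ^+ 3.
  have e1 : `|z + s| = s + z by rewrite ger0_norm; lra.
  have e2 : `|z - s| = s - z by rewrite ler0_norm; lra.
  by rewrite /symm_sum e1 e2 pE !powR_mulrn//; lra.
have -> : tangent_slope z b = 3 * (z ^+ 2 + b ^+ 2) / b.
  rewrite /tangent_slope pE (_ : 3 - 2 = 1); last by ring.
  have e1 : `|z + b| = b + z by rewrite ger0_norm; lra.
  have e2 : `|z - b| = b - z by rewrite ler0_norm; lra.
  have e3 : z - b = - (b - z) by ring.
  have b0' : b != 0 by rewrite gt_eqF.
  rewrite e1 e2 !powRr1; [|lra|lra].
  by field.
rewrite -subr_ge0.
have -> : (s + z) ^+ 3 + (s - z) ^+ 3 - ((b + z) ^+ 3 + (b - z) ^+ 3 +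
  3 * (z ^+ 2 + b ^+ 2) / b * (s ^+ 2 - b ^+ 2) + b ^+ 3) =
  ((s - b) ^+ 2 * (2 * s + b - 3 * z ^+ 2 / b)) - b ^+ 3.
  by field; rewrite gt_eqF.
rewrite subr_ge0.
have zb : z ^+ 2 / b <= b / 4.
  rewrite ler_pdivrMr//.
  suff : 0 <= (b / 2 - z) * (b / 2 + z) by lra.
  by rewrite mulr_ge0//; lra.
have h1 : b <= 2 * s + b - 3 * z ^+ 2 / b by lra.
have h2 : b ^+ 2 <= (s - b) ^+ 2 by rewrite ler_sqr ?nnegrE; lra.
by rewrite exprS mulrC; apply: ler_pM => //; rewrite ?sqr_ge0//; lra.
Qed.

(* For p > 3 the convexity of the second derivative is strict away from the
   origin; for p = 3 it is carried by the kink at the origin. *)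
Lemma symm_sum_gap : exists2 k : R, 0 < k & forall b, 0 < b <= 1 ->
  exists l u c : R, [/\ -6 <= l, l <= u, u <= 6, 0 <= c &
    k * b ^+ 4 <= c * (u - l) /\
    forall z g, l <= z <= u -> 2 <= g <= 3 ->
      symm_sum z b + tangent_slope z b * ((b * g) ^+ 2 - b ^+ 2) + c
        <= symm_sum z (b * g)].
Proof.
have p3 := p_ge3.
have [p3'|] := ltP 3 p; last first.
  move=> p3'; have pE : p = 3 by apply/le_anti; rewrite p3 p3'.
  exists 1 => // b /andP[b0 b1].
  (* Window of length b, gap b^3. The product is what counts, as the probability of hitting the
     window will be proportional to its length. *)
  exists (- b / 2), (b / 2), (b ^+ 3); split; try lra; first by rewrite exprn_ge0// ltW.
  split; first by rewrite (_ : b / 2 - _ = b); [rewrite mul1r -exprSr|field].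
  move=> z g lzu /andP[g2 _]; apply: symm_sum_gap_eq3 => //.
  by rewrite mulrC ler_wpM2l// ltW.
pose k := p * (p - 1) * (p - 2) * (p - 3) / 108.
have k0 : 0 < k by rewrite divr_gt0// !mulr_gt0//; lra.
exists k => // b /andP[b0 b1].
(* Window of length 1, gap k b^4: for [2 <= g] the factor (g^2 - 1)^2 is at least 1, and [g <= 3]
   keeps b g inside the range of [symm_sum_gap_gt3]. *)
exists 5, 6, (k * b ^+ 4); split; try lra.
  by rewrite mulr_ge0 ?exprn_ge0// ltW.
split; first by rewrite (_ : 6 - 5 = 1) ?mulr1//; ring.
move=> z g z56 /andP[g2 g3].
have bg0 : 0 <= b * g by rewrite mulr_ge0//; lra.
have bg3 : b * g <= 3 by nra.
have b03 : 0 < b <= 3 by apply/andP; split; lra.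
have bg03 : 0 <= b * g <= 3 by apply/andP; split.
apply: (le_trans _ (symm_sum_gap_gt3 p3' z56 b03 bg03)); rewrite -/k.
set A := symm_sum z b + _; suff : k * b ^+ 4 <= k * ((b * g) ^+ 2 - b ^+ 2) ^+ 2 by lra.
rewrite ler_pM2l//.
have -> : ((b * g) ^+ 2 - b ^+ 2) ^+ 2 = (g ^+ 2 - 1) ^+ 2 * b ^+ 4 by ring.
have g21 : 1 <= g ^+ 2 - 1 by nra.
have g22 : 1 <= (g ^+ 2 - 1) ^+ 2 by nra.
by rewrite ler_peMl ?exprn_ge0 ?(ltW b0).
Qed.
End gap.

(** * Gaussian integrals *)

Section gaussian_integral.
Context {R : realType}.
Local Open Scope ereal_scope.
Implicit Types (f : R -> \bar R) (m s : R).
Local Notation mu := (@lebesgue_measure R).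

Lemma preimage_affine_itv m s (a b : R) : (0 < s)%R ->
  (fun x : R => m + s * x)%R @^-1` `]a, b]%classic =
  `](a - m) / s, (b - m) / s]%classic%R.
Proof.
move=> s0; apply/seteqP; split => x /=; rewrite !in_itv/= => /andP[h1 h2];
  apply/andP; split.
- by rewrite ltr_pdivrMr// mulrC ltrBlDl.
- by rewrite ler_pdivlMr// mulrC lerBrDl.
- by rewrite -ltrBlDl mulrC -ltr_pdivrMr.
- by rewrite -lerBrDl mulrC -ler_pdivlMr.
Qed.

Lemma measurable_affine m s :
  measurable_fun [set: R] (fun x : measurableTypeR R => (m + s * x)%R : measurableTypeR R).
Proof. exact: measurable_funD. Qed.

(** The scaled image of Lebesgue measure agrees with it on half-open intervals, hence everywhere by
    uniqueness. *)
Lemma lebesgue_measure_affine m s (A : set R) : (0 < s)%R -> measurable A ->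
  s%:E * mu ((fun x : R => m + s * x)%R @^-1` A) = mu A.
Proof.
move=> s0 mA.
pose nu := mscale (NngNum (ltW s0))
  (measure_function_pushforward__canonical__measure_function_Measure
    mu (measurable_affine m s)).
have mu_nu (X : set R) : ocitv X -> mu X = nu X.
  move=> [[a b]] _ <-.
  rewrite /nu /mscale/= /pushforward preimage_affine_itv// !lebesgue_measure_itv/=.
  rewrite !lte_fin ltr_pM2r ?invr_gt0// ltrD2r; case: ifPn => ab; last by rewrite mule0.
  by rewrite -!EFinD -EFinM; congr (_%:E); field; rewrite gt_eqF.
by rewrite (lebesgue_measure_unique (mu := nu) mu_nu mA).
Qed.

Lemma ge0_integral_affine f m s : (0 < s)%R -> measurable_fun [set: R] f ->
  (forall x, 0 <= f x) ->
  \int[mu]_x f x = s%:E * \int[mu]_x f (m + s * x)%R.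
Proof.
move=> s0 mf f0.
pose aff : measurableTypeR R -> measurableTypeR R := fun x => (m + s * x)%R.
have maff : measurable_fun [set: measurableTypeR R] aff by exact: measurable_affine.
pose nu := mscale (NngNum (ltW s0))
  (measure_function_pushforward__canonical__measure_function_Measure mu maff).
have -> : \int[mu]_x f x = \int[nu]_x f x.
  apply: eq_measure_integral => A mA _.
  exact/esym/lebesgue_measure_affine.
rewrite /nu ge0_integral_mscale//; congr (_ * _).
by rewrite ge0_integral_pushforward.
Qed.

(** The Radon-Nikodym derivative of [normal_prob] equals [normal_pdf] almost everywhere, since both
    have the same integral over every measurable set. *)
Lemma ge0_integral_normal_prob m s f : measurable_fun [set: R] f ->
  (forall x, 0 <= f x) ->
  \int[normal_prob m s]_x f x = \int[mu]_x (f x * (normal_pdf m s x)%:E).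
Proof.
move=> mf f0.
have dom : normal_prob m s `<< mu by exact: normal_prob_dominates.
have RNi := Radon_Nikodym_SigmaFinite.f_integrable dom.
have mpdf : measurable_fun [set: R] (EFin \o normal_pdf m s).
  by apply/measurable_EFinP; exact: measurable_normal_pdf.
rewrite -(Radon_Nikodym_SigmaFinite.change_of_variables dom f0)//.
apply: ge0_ae_eq_integral => //.
- by apply: emeasurable_funM => //; exact: measurable_int RNi.
- by apply: emeasurable_funM.
- by move=> x _; rewrite mule_ge0// Radon_Nikodym_SigmaFinite.f_ge0.
- by move=> x _; rewrite mule_ge0// lee_fin normal_pdf_ge0.
apply: ae_eqe_mul2l; apply: integral_ae_eq => //= E _ mE.
by rewrite -Radon_Nikodym_SigmaFinite.f_integral.
Qed.

Lemma normal_pdf_affine m s x : (0 < s)%R ->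
  (s * normal_pdf m s (m + s * x) = normal_pdf 0 1 x)%R.
Proof.
move=> s0; rewrite !normal_pdfE ?oner_eq0 ?gt_eqF//.
rewrite /normal_peak /normal_fun expr1n mul1r subr0 addrAC subrr add0r mulrA.
congr (_ * expR _)%R; last by field; rewrite gt_eqF.
rewrite -(mulrnAr _ pi) sqrtrM ?sqr_ge0// sqrtr_sqr gtr0_norm//.
by rewrite invfM mulrA divff ?mul1r// gt_eqF.
Qed.

Lemma ge0_integral_normal_affine f m s : (0 < s)%R -> measurable_fun [set: R] f ->
  (forall x, 0 <= f x) ->
  \int[normal_prob 0 1]_x f (m + s * x)%R = \int[normal_prob m s]_x f x.
Proof.
move=> s0 mf f0.
have mfa : measurable_fun [set: R] (fun x => f (m + s * x)%R).
  exact: (measurableT_comp mf (measurable_affine m s)).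
apply: eq_trans (ge0_integral_normal_prob 0 1 mfa _) _; first by move=> x.
apply/esym; apply: eq_trans (ge0_integral_normal_prob m s mf f0) _.
have mfp : measurable_fun [set: R] (fun x => f x * (normal_pdf m s x)%:E).
  apply: emeasurable_funM => //.
  by apply/measurable_EFinP; exact: measurable_normal_pdf.
rewrite (ge0_integral_affine m s0 mfp); last first.
  by move=> x; rewrite mule_ge0// lee_fin normal_pdf_ge0.
rewrite -ge0_integralZl_EFin ?(ltW s0)//.
- apply: eq_integral => x _.
  by rewrite -(normal_pdf_affine m x s0) EFinM muleCA.
- by move=> x _; rewrite mule_ge0// lee_fin normal_pdf_ge0.
- exact: (measurableT_comp mfp (measurable_affine m s)).
Qed.

Lemma ge0_integral_normalN f : measurable_fun [set: R] f -> (forall x, 0 <= f x) ->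
  \int[normal_prob 0 1]_x f (- x)%R = \int[normal_prob 0 1]_x f x.
Proof.
move=> mf f0.
have mN : measurable_fun [set: measurableTypeR R] (-%R : measurableTypeR R -> measurableTypeR R).
  by [].
have mfN : measurable_fun [set: R] (f \o -%R) by exact: (measurableT_comp mf mN).
have mpdf : measurable_fun [set: R] (EFin \o normal_pdf 0 1).
  by apply/measurable_EFinP; exact: measurable_normal_pdf.
rewrite (ge0_integral_normal_prob 0 1 mfN)//= (ge0_integral_normal_prob 0 1 mf)//.
transitivity (\int[pushforward mu (-%R : _ -> measurableTypeR R)]_x
    (f x * (normal_pdf 0 1 x)%:E)); last first.
  by apply: eq_measure_integral => A mA _; exact: lebesgue_measureN.
have mfp : measurable_fun [set: measurableTypeR R] (fun x => f x * (normal_pdf 0 1 x)%:E).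
  exact: emeasurable_funM.
have fp0 : {in [set: measurableTypeR R], forall x, 0 <= f x * (normal_pdf 0 1 x)%:E}.
  by move=> x _; rewrite mule_ge0// lee_fin normal_pdf_ge0.
apply/esym; apply: eq_trans (ge0_integral_pushforward mN mu measurableT mfp fp0) _.
apply: eq_integral => x _ /=; congr (_ * _%:E).
by rewrite !normal_pdfE ?oner_eq0// /normal_fun !subr0 sqrrN.
Qed.

End gaussian_integral.

(** * Finiteness of Gaussian moments and the value of the second one *)

Section gaussian_moments.
Context {R : realType}.
Local Open Scope ereal_scope.
Implicit Types (f : R -> \bar R) (x y z m s a : R).
Local Notation mu := (@lebesgue_measure R).
Local Notation gauss := (@normal_prob R 0 1).

Lemma normal_peak_gt0E s : (0 < s)%R ->
  (normal_peak s = s^-1 * (Num.sqrt (pi *+ 2))^-1 :> R)%R.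
Proof.
move=> s0; rewrite /normal_peak -mulrnAr sqrtrM ?sqr_ge0// sqrtr_sqr gtr0_norm//.
by rewrite invfM.
Qed.

Lemma normal_pdf_mul_expR s x : (0 < s)%R ->
  (expR ((1 - s ^- 2) * x ^+ 2 / 2) * normal_pdf 0 1 x = s * normal_pdf 0 s x)%R.
Proof.
move=> s0; rewrite !normal_pdfE ?oner_eq0 ?gt_eqF//.
rewrite !normal_peak_gt0E// mulrCA -expRD invr1 mul1r.
rewrite !mulrA divff ?gt_eqF// mul1r; congr (_ * expR _)%R.
by rewrite !subr0; field; rewrite gt_eqF.
Qed.

(** Tilting the standard density by this exponential gives s times the density of deviation [s]. The
    case s = sqrt 2 bounds all moments; s near 1 determines the second moment. *)
Lemma integral_gauss_expR s : (0 < s)%R ->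
  \int[gauss]_x (expR ((1 - s ^- 2) * x ^+ 2 / 2))%:E = s%:E.
Proof.
move=> s0.
have mexp : measurable_fun [set: R] (fun x => (expR ((1 - s ^- 2) * x ^+ 2 / 2))%:E).
  apply/measurable_EFinP; apply: measurableT_comp => //.
  by apply: measurable_funM => //; apply: measurable_funM.
rewrite (ge0_integral_normal_prob 0 1 mexp); last first.
  by move=> x; rewrite lee_fin expR_ge0.
under eq_integral do rewrite -EFinM normal_pdf_mul_expR// EFinM.
rewrite ge0_integralZl_EFin ?(ltW s0)//.
- by rewrite integral_normal_pdf mule1.
- by move=> x _; rewrite lee_fin normal_pdf_ge0.
- by apply/measurable_EFinP; exact: measurable_normal_pdf.
Qed.

Lemma measurable_norm_powR (p : R) :
  measurable_fun [set: R] (fun x => (`|x| `^ p)%:E).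
Proof.
apply/measurable_EFinP.
by apply: (measurableT_comp (measurable_powR p)); exact: normr_measurable.
Qed.

(** For |x| > 1 the Taylor term of exp(x^2 / 4) of order n + 1, with 2 (n + 1) >= p, dominates
    |x|^p; the summand 1 of the constant covers |x| <= 1. *)
Lemma norm_powR_le_expR (p : R) : (0 <= p)%R ->
  exists2 C : R, (0 <= C)%R & forall x : R, (`|x| `^ p <= C * expR (x ^+ 2 / 4))%R.
Proof.
move=> p0.
pose n := Num.bound p.
have pn : (p <= 2 * n.+1%:R)%R.
  have := archi_boundP p0; rewrite -/n => h.
  by rewrite -natr1; have := ler0n R n; lra.
exists (1 + 4 ^+ n.+1 * n.+1`!%:R)%R.
  by rewrite addr_ge0// mulr_ge0// exprn_ge0.
move=> x.
have y0 : (0 <= x ^+ 2 / 4)%R by rewrite divr_ge0// sqr_ge0.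
have e1 : (1 <= expR (x ^+ 2 / 4))%R by rewrite -[leLHS]expR0 ler_expR.
have [x1|x1] := leP `|x|%R 1%R.
  apply: (@le_trans _ _ 1%R).
    have := @ge0_ler_powR R p p0 `|x|%R 1%R; rewrite !nnegrE powR1; exact.
  have c0 : (0 <= 4 ^+ n.+1 * n.+1`!%:R :> R)%R by rewrite mulr_ge0// exprn_ge0.
  by rewrite -[leLHS]mulr1; apply: ler_pM => //; rewrite lerDl.
apply: (@le_trans _ _ (`|x| `^ (2 * n.+1%:R))%R).
  by apply: ler_powR => //; exact: ltW.
rewrite powRrM [(_ `^ 2)%R](powR_mulrn 2)// real_normK ?num_real// powR_mulrn ?sqr_ge0//.
have h := expR_ge1Dxn n y0.
rewrite mulrDl mul1r.
have -> : ((x ^+ 2) ^+ n.+1 = 4 ^+ n.+1 * n.+1`!%:R * ((x ^+ 2 / 4) ^+ n.+1 / n.+1`!%:R))%R.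
  have f0 : (n.+1`!%:R != 0 :> R)%R by rewrite pnatr_eq0 -lt0n fact_gt0.
  have e0 : (4 ^+ n.+1 != 0 :> R)%R by rewrite expf_neq0.
  by rewrite expr_div_n; field; rewrite f0 e0.
apply: ler_wpDl; first exact: expR_ge0.
have c0 : (0 <= 4 ^+ n.+1 * n.+1`!%:R :> R)%R by rewrite mulr_ge0// exprn_ge0.
by apply: (ler_wpM2l c0); lra.
Qed.

Lemma gauss_moment_lty (p : R) : (0 <= p)%R ->
  \int[gauss]_x (`|x| `^ p)%:E < +oo.
Proof.
move=> p0; have [C C0 hC] := norm_powR_le_expR p0.
have s0 : (0 < Num.sqrt 2 :> R)%R by rewrite sqrtr_gt0.
have mexp : measurable_fun [set: R] (fun x => (expR (x ^+ 2 / 4))%:E).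
  apply/measurable_EFinP; apply: measurableT_comp => //.
  by apply: measurable_funM.
apply: (@le_lt_trans _ _ (\int[gauss]_x (C%:E * (expR (x ^+ 2 / 4))%:E))).
  apply: ge0_le_integral => //.
  - exact: measurable_norm_powR.
  - exact: emeasurable_funM.
  - by move=> x _; rewrite -EFinM lee_fin.
rewrite ge0_integralZl_EFin//.
have -> : \int[gauss]_x (expR (x ^+ 2 / 4))%:E = (Num.sqrt 2)%:E.
  rewrite -(integral_gauss_expR s0); apply: eq_integral => x _.
  congr ((expR _)%:E); rewrite sqr_sqrtr//; by field.
by rewrite -EFinM ltry.
Qed.

(** Bounding the exponential in [integral_gauss_expR] below by its tangent gives (1 - s^-2) w <= 2
    (s - 1) for every s > 0, where w is the moment. After division by s - 1, letting s tend to 1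
    from above and from below yields w <= 1 and w >= 1. *)
Lemma gauss_second_moment : \int[gauss]_x (x ^+ 2)%:E = 1%E.
Proof.
have sqE x : (x ^+ 2 = `|x| `^ 2)%R.
  by rewrite (powR_mulrn 2)// real_normK ?num_real.
set v := LHS.
have v0 : 0 <= v by apply: integral_ge0 => x _; rewrite lee_fin sqr_ge0.
have vfin : v \is a fin_num.
  rewrite ge0_fin_numE// /v; under eq_integral do rewrite sqE.
  by apply: gauss_moment_lty.
rewrite -(fineK vfin); congr _%:E; set w := fine v.
have w0 : (0 <= w)%R by exact: fine_ge0.
have msq : measurable_fun [set: R] (fun x => (x ^+ 2)%:E).
  by apply/measurable_EFinP.
have key s : (0 < s)%R -> ((1 - s ^- 2) * w <= 2 * (s - 1))%R.
  move=> s0; have := integral_gauss_expR s0.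
  have mexp : measurable_fun [set: R] (fun x => (expR ((1 - s ^- 2) * x ^+ 2 / 2))%:E).
    apply/measurable_EFinP; apply: measurableT_comp => //.
    by apply: measurable_funM => //; apply: measurable_funM.
  (* If the coefficient of x^2 is negative, the term moves to the other side, so that only
     nonnegative functions are integrated. *)
  have [k0|k0] := leP 0%R (1 - s ^- 2)%R.
    have : \int[gauss]_x (1%:E + ((1 - s ^- 2) / 2)%:E * (x ^+ 2)%:E) <=
        \int[gauss]_x (expR ((1 - s ^- 2) * x ^+ 2 / 2))%:E.
      apply: ge0_le_integral => //.
      - move=> x _; rewrite -EFinM -EFinD lee_fin addr_ge0// mulr_ge0 ?sqr_ge0//.
        by rewrite divr_ge0.
      - by apply: emeasurable_funD => //; exact: emeasurable_funM.
      - move=> x _; rewrite -EFinM -EFinD lee_fin.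
        by apply: le_trans (expR_ge1Dx _); rewrite lerD2l mulrAC.
    rewrite ge0_integralD//; last 2 first.
    - by move=> x _; rewrite -EFinM lee_fin mulr_ge0 ?sqr_ge0// divr_ge0.
    - exact: emeasurable_funM.
    rewrite ge0_integralZl_EFin; [|by []|by move=> x _; rewrite lee_fin sqr_ge0|exact: msq|by rewrite divr_ge0].
    rewrite integral_cst//= probability_setT mule1 -/v -(fineK vfin) -/w => h hs.
    by move: h; rewrite hs -EFinM -EFinD lee_fin; lra.
  have k0' : (0 <= - ((1 - s ^- 2) / 2))%R by lra.
  have : \int[gauss]_x 1%:E <=
      \int[gauss]_x ((expR ((1 - s ^- 2) * x ^+ 2 / 2))%:E +
        (- ((1 - s ^- 2) / 2))%:E * (x ^+ 2)%:E).
    apply: ge0_le_integral => //.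
    - by apply: emeasurable_funD => //; exact: emeasurable_funM.
    - move=> x _; rewrite -EFinM -EFinD lee_fin.
      have := expR_ge1Dx ((1 - s ^- 2) * x ^+ 2 / 2); lra.
  rewrite ge0_integralD//; last 2 first.
  - by move=> x _; rewrite -EFinM lee_fin mulr_ge0 ?sqr_ge0.
  - exact: emeasurable_funM.
  rewrite ge0_integralZl_EFin; [|by []|by move=> x _; rewrite lee_fin sqr_ge0|exact: msq|exact: k0'].
  rewrite integral_cst//= probability_setT mule1 -/v -(fineK vfin) -/w => h hs.
  by move: h; rewrite hs -EFinM -EFinD lee_fin; lra.
have key2 s : (0 < s)%R -> ((s - 1) * ((s + 1) * w - 2 * s ^+ 2) <= 0)%R.
  move=> s0; have h := key s s0.
  have s20 : (0 < s ^+ 2)%R by rewrite exprn_gt0.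
  have -> : ((s - 1) * ((s + 1) * w - 2 * s ^+ 2) = s ^+ 2 * ((1 - s ^- 2) * w - 2 * (s - 1)))%R.
    by field; rewrite gt_eqF.
  by rewrite pmulr_rle0// subr_le0.
apply/eqP; rewrite eq_le; apply/andP; split; apply/ler_addgt0Pl => e e0.
- pose t : R := Num.min (e / 8)%R 1%R.
  have t0 : (0 < t)%R by rewrite lt_min divr_gt0//=.
  have te : (t <= e / 8)%R by rewrite /t ge_min lexx.
  have t1 : (t <= 1)%R by rewrite /t ge_min lexx orbT.
  have := key2 (1 + t)%R (ltr_pwDl ltr01 (ltW t0)).
  rewrite [(1 + t - 1)%R]addrAC subrr add0r pmulr_rle0// => h.
  have wt : (0 <= w * t)%R by rewrite mulr_ge0// ltW.
  have tt : (t ^+ 2 <= t)%R by rewrite expr2 ler_piMl// ltW.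
  by lra.
- pose t : R := Num.min (e / 8)%R (1 / 2)%R.
  have t0 : (0 < t)%R by rewrite lt_min !divr_gt0//=.
  have te : (t <= e / 8)%R by rewrite /t ge_min lexx.
  have t1 : (t <= 1 / 2)%R by rewrite /t ge_min lexx orbT.
  have := key2 (1 - t)%R; rewrite [(1 - t - 1)%R]addrAC subrr sub0r.
  have -> : (0 < 1 - t)%R by lra.
  move=> /(_ isT); rewrite mulNr oppr_le0 pmulr_rge0// => h.
  have wt : (0 <= w * t)%R by rewrite mulr_ge0// ltW.
  have tt : (0 <= t ^+ 2)%R by rewrite sqr_ge0.
  by lra.
Qed.
End gaussian_moments.

(** * Convolution of Gaussian kernels *)

Section gaussian_semigroup.
Context {R : realType}.
Local Open Scope ereal_scope.
Implicit Types (f : R -> \bar R) (x y z m s a : R).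
Local Notation mu := (@lebesgue_measure R).
Local Notation gauss := (@normal_prob R 0 1).

(** Disintegration of a Gaussian pair in the two possible orders: z around x and y around z on the
    left, y around x and then z given y on the right. *)
Lemma normal_pdf_conv x y z s a : (0 < s)%R -> (0 < a)%R ->
  let c := Num.sqrt (s ^+ 2 + a ^+ 2)%R in
  (normal_pdf z a y * normal_pdf x s z =
   normal_pdf x c y *
     normal_pdf ((x * a ^+ 2 + y * s ^+ 2) / c ^+ 2) (s * a / c) z)%R.
Proof.
move=> s0 a0 c.
have c20 : (0 < s ^+ 2 + a ^+ 2)%R by rewrite addr_gt0 ?exprn_gt0.
have c0 : (0 < c)%R by rewrite sqrtr_gt0.
have c2 : (c ^+ 2 = s ^+ 2 + a ^+ 2)%R by rewrite sqr_sqrtr// ltW.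
have sac0 : (0 < s * a / c)%R by rewrite divr_gt0// mulr_gt0.
rewrite !normal_pdfE ?gt_eqF// !normal_peak_gt0E//.
set k := (Num.sqrt _)^-1%R.
rewrite /normal_fun [LHS]mulrACA [RHS]mulrACA -!expRD; congr (_ * expR _)%R.
  by field; rewrite !gt_eqF.
have e1 : ((s * a / c) ^+ 2 = s ^+ 2 * a ^+ 2 / (s ^+ 2 + a ^+ 2))%R.
  by rewrite expr_div_n exprMn c2.
by rewrite e1 c2; field; rewrite !gt_eqF.
Qed.

Lemma measurable_affine2 s : measurable_fun [set: R * R]
  (fun u : measurableTypeR R * measurableTypeR R => (u.1 + s * u.2)%R : measurableTypeR R).
Proof.
apply: measurable_funD; first exact: measurable_fst.
by apply: measurable_funM => //; exact: measurable_snd.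
Qed.

Lemma ge0_measurable_integral_gauss f s : measurable_fun [set: R] f ->
  (forall x, 0 <= f x) ->
  measurable_fun [set: R] (fun x => \int[gauss]_g f (x + s * g)%R).
Proof.
move=> mf f0.
have mF : measurable_fun [set: measurableTypeR R * measurableTypeR R]
    (fun u => f (u.1 + s * u.2)%R).
  exact: (measurableT_comp mf (measurable_affine2 s)).
have h := @measurable_fun_fubini_tonelli_F _ _ _ _ R gauss _ mF (fun u => f0 _).
exact: h.
Qed.

(** By Tonelli and [normal_pdf_conv], the intermediate point z is integrated out through its
    conditional density, which has mass 1. *)
Lemma gauss_conv f x s a : measurable_fun [set: R] f -> (forall x, 0 <= f x) ->
  (0 < s)%R -> (0 < a)%R ->
  \int[gauss]_h \int[gauss]_g f (x + s * h + a * g)%R =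
  \int[gauss]_g f (x + Num.sqrt (s ^+ 2 + a ^+ 2) * g)%R.
Proof.
move=> mf f0 s0 a0; set c := Num.sqrt _.
have c0 : (0 < c)%R by rewrite sqrtr_gt0 addr_gt0 ?exprn_gt0.
pose F z := \int[gauss]_g f (z + a * g)%R.
have mF : measurable_fun [set: R] F by exact: ge0_measurable_integral_gauss.
have F0 z : 0 <= F z by exact: integral_ge0.
have FE z : F z = \int[mu]_y (f y * (normal_pdf z a y)%:E).
  rewrite /F; apply: eq_trans (ge0_integral_normal_affine z a0 mf f0) _.
  exact: ge0_integral_normal_prob.
have -> : \int[gauss]_h \int[gauss]_g f (x + s * h + a * g)%R =
    \int[mu]_z (F z * (normal_pdf x s z)%:E).
  apply: eq_trans (ge0_integral_normal_affine x s0 mF F0) _.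
  exact: ge0_integral_normal_prob.
apply/esym; apply: eq_trans (ge0_integral_normal_affine x c0 mf f0) _.
apply: eq_trans (ge0_integral_normal_prob x c mf f0) _.
have mpdf2 (t : R) : (0 < t)%R -> measurable_fun
    [set: measurableTypeR R * measurableTypeR R] (fun u => normal_pdf u.1 t u.2).
  move=> t0.
  have -> : (fun u : R * R => normal_pdf u.1 t u.2) =
      (normal_pdf 0 t) \o (fun u => (u.2 - u.1)%R).
    apply/funext => u /=; rewrite !normal_pdfE ?gt_eqF//.
    by rewrite /normal_fun subr0.
  apply: measurableT_comp; first exact: measurable_normal_pdf.
  by apply: measurable_funB; [exact: measurable_snd|exact: measurable_fst].
pose H (u : measurableTypeR R * measurableTypeR R) :=
  f u.2 * (normal_pdf u.1 a u.2 * normal_pdf x s u.1)%:E.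
have mH : measurable_fun [set: measurableTypeR R * measurableTypeR R] H.
  apply: emeasurable_funM; first exact: (measurableT_comp mf measurable_snd).
  apply/measurable_EFinP; apply: measurable_funM; first exact: mpdf2.
  exact: (measurableT_comp (measurable_normal_pdf x s) measurable_fst).
have H0 u : 0 <= H u.
  by rewrite mule_ge0// lee_fin mulr_ge0 ?normal_pdf_ge0.
have := @fubini_tonelli _ _ _ _ R mu mu H mH H0; rewrite /H /= => FT.
transitivity (\int[mu]_y \int[mu]_z
    (f y * (normal_pdf z a y * normal_pdf x s z)%:E)).
  apply: eq_integral => y _.
  set m' := ((x * a ^+ 2 + y * s ^+ 2) / c ^+ 2)%R; set s' := (s * a / c)%R.
  have E z : f y * (normal_pdf z a y * normal_pdf x s z)%:E =
      (f y * (normal_pdf x c y)%:E) * (normal_pdf m' s' z)%:E.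
    by rewrite (normal_pdf_conv x y z s0 a0) EFinM muleA.
  have mp : measurable_fun [set: measurableTypeR R] (fun z => (normal_pdf m' s' z)%:E).
    by apply/measurable_EFinP; exact: measurable_normal_pdf.
  have p0 z : [set: measurableTypeR R] z -> 0 <= (normal_pdf m' s' z)%:E.
    by rewrite lee_fin normal_pdf_ge0.
  have fp0 : 0 <= f y * (normal_pdf x c y)%:E.
    by apply: mule_ge0; [exact: f0|rewrite lee_fin; exact: normal_pdf_ge0].
  have Z := @ge0_integralZl _ (measurableTypeR R) R mu setT measurableT _ mp _ p0 fp0.
  apply/esym.
  transitivity (\int[mu]_z ((f y * (normal_pdf x c y)%:E) * (normal_pdf m' s' z)%:E)).
    by apply: eq_integral => z _; exact: E.
  by rewrite Z integral_normal_pdf mule1.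
apply: eq_trans (esym FT) _.
apply: eq_integral => z _.
have E y : f y * (normal_pdf z a y * normal_pdf x s z)%:E =
    (f y * (normal_pdf z a y)%:E) * (normal_pdf x s z)%:E.
  by rewrite EFinM muleA.
transitivity (\int[mu]_y ((f y * (normal_pdf z a y)%:E) * (normal_pdf x s z)%:E)).
  by apply: eq_integral => y _; exact: E.
have mp : measurable_fun [set: measurableTypeR R] (fun y => f y * (normal_pdf z a y)%:E).
  apply: emeasurable_funM; first exact: mf.
  by apply/measurable_EFinP; exact: measurable_normal_pdf.
have p0 y : [set: measurableTypeR R] y -> 0 <= f y * (normal_pdf z a y)%:E.
  by move=> _; apply: mule_ge0; [exact: f0|rewrite lee_fin; exact: normal_pdf_ge0].
have fp0 : 0 <= (normal_pdf x s z)%:E by rewrite lee_fin; exact: normal_pdf_ge0.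
have Z := @ge0_integralZr _ (measurableTypeR R) R mu setT measurableT _ mp _ p0 fp0.
by rewrite Z FE.
Qed.
End gaussian_semigroup.

(** * Gaussian smoothing of |x|^p *)

Section smoothing.
Context {R : realType} (p : R).
Hypothesis p_ge3 : 3 <= p.
Local Open Scope ereal_scope.
Implicit Types (x y z s a b c g l u : R).
Local Notation mu := (@lebesgue_measure R).
Local Notation gauss := (@normal_prob R 0 1).

Definition smooth s x : R := fine (\int[gauss]_g (`|x + s * g| `^ p)%:E).

Lemma measurable_norm_powR_affine x s :
  measurable_fun [set: R] (fun g => (`|x + s * g| `^ p)%:E).
Proof.
exact: (measurableT_comp (measurable_norm_powR p) (measurable_affine x s)).
Qed.

Lemma norm_powR_ge0 x : 0 <= (`|x| `^ p)%:E.
Proof. by rewrite lee_fin; exact: powR_ge0. Qed.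

Lemma smooth_EFin s x : (smooth s x)%:E = \int[gauss]_g (`|x + s * g| `^ p)%:E.
Proof.
have p3 := p_ge3; have p0 : (0 <= p)%R by lra.
rewrite fineK// ge0_fin_numE; last first.
  by apply: integral_ge0 => g _; exact: norm_powR_ge0.
(* x + s g is the midpoint of 2 x and 2 s g, so convexity dominates the integrand by A + B |g|^p. *)
set A := (2^-1 * `|2 * x| `^ p)%R; set B := (2^-1 * `|2 * s| `^ p)%R.
have A0 : (0 <= A)%R by rewrite mulr_ge0// powR_ge0.
have B0 : (0 <= B)%R by rewrite mulr_ge0// powR_ge0.
have mg := measurable_norm_powR p.
apply: (@le_lt_trans _ _ (\int[gauss]_g (A%:E + B%:E * (`|g| `^ p)%:E))).
  apply: ge0_le_integral.
  - by [].
  - by move=> g _; exact: norm_powR_ge0.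
  - exact: measurable_norm_powR_affine.
  - by apply: emeasurable_funD => //; exact: emeasurable_funM.
  - move=> g _; rewrite -EFinM -EFinD lee_fin.
    have h2 : (0 <= (2^-1 : R) <= 1)%R by lra.
    have p1 : (1 <= p)%R by lra.
    have := norm_powR_convex (2 * x)%R (2 * (s * g))%R p1 h2.
    have -> : (2^-1 * (2 * x) + (1 - 2^-1) * (2 * (s * g)) = x + s * g)%R by field.
    have -> : (2 * (s * g) = (2 * s) * g)%R by ring.
    rewrite (normrM (2 * s)%R) powRM//.
    have -> : (1 - 2^-1 = 2^-1 :> R)%R by field.
    by rewrite mulrA.
rewrite ge0_integralD.
- rewrite integral_cst//= probability_setT mule1 ge0_integralZl_EFin//.
    by rewrite lte_add_pinfty ?ltry// lte_mul_pinfty// gauss_moment_lty.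
- by [].
- by move=> g _; rewrite lee_fin.
- exact: measurable_cst.
- by move=> g _; rewrite -EFinM lee_fin mulr_ge0// powR_ge0.
- exact: emeasurable_funM.
Qed.

Lemma smooth_ge0 s x : (0 <= smooth s x)%R.
Proof. by apply: fine_ge0; apply: integral_ge0 => g _; exact: norm_powR_ge0. Qed.

#[local] Opaque smooth.

Lemma smooth0 x : smooth 0 x = (`|x| `^ p)%R.
Proof.
apply: EFin_inj; rewrite smooth_EFin.
under eq_integral do rewrite mul0r addr0.
by rewrite integral_cst//= probability_setT mule1.
Qed.

Lemma measurable_smooth s : measurable_fun [set: R] (smooth s).
Proof.
apply/measurable_EFinP.
have -> : EFin \o smooth s = (fun x => \int[gauss]_g (`|x + s * g| `^ p)%:E).
  by apply/funext => x /=; rewrite smooth_EFin.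
apply: (@ge0_measurable_integral_gauss R (fun y => (`|y| `^ p)%:E)).
- exact: measurable_norm_powR.
- exact: norm_powR_ge0.
Qed.

Lemma measurable_smooth_affine s x a :
  measurable_fun [set: R] (fun h => (smooth a (x + s * h))%:E).
Proof.
apply/measurable_EFinP.
exact: (measurableT_comp (measurable_smooth a) (measurable_affine x s)).
Qed.

Lemma smooth_semigroup s a x : (0 <= s)%R -> (0 <= a)%R ->
  \int[gauss]_h (smooth a (x + s * h))%:E = (smooth (Num.sqrt (s ^+ 2 + a ^+ 2)) x)%:E.
Proof.
rewrite !le_eqVlt => /orP[/eqP<-|s0] /orP[/eqP<-|a0].
- under eq_integral do rewrite mul0r addr0.
  by rewrite integral_cst//= probability_setT mule1 expr0n/= addr0 sqrtr0.
- under eq_integral do rewrite mul0r addr0.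
  by rewrite integral_cst//= probability_setT mule1 expr0n/= add0r sqrtr_sqr gtr0_norm.
- under eq_integral do rewrite smooth0.
  by rewrite smooth_EFin expr0n/= addr0 sqrtr_sqr gtr0_norm.
rewrite smooth_EFin.
apply/esym; apply: eq_trans (esym (gauss_conv x (measurable_norm_powR p) norm_powR_ge0 s0 a0)) _.
by apply: eq_integral => h _; rewrite smooth_EFin.
Qed.

Lemma measurable_symm_sum z b :
  measurable_fun [set: R] (fun g => (symm_sum p z (b * g))%:E).
Proof.
rewrite /symm_sum; under eq_fun do rewrite EFinD -mulNr.
by apply: emeasurable_funD; exact: measurable_norm_powR_affine.
Qed.

Lemma symm_sum_ge0 z a : (0 <= symm_sum p z a)%R.
Proof. by rewrite addr_ge0 ?powR_ge0. Qed.

Lemma integral_symm_sum z b :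
  \int[gauss]_g (symm_sum p z (b * g))%:E = (2 * smooth b z)%:E.
Proof.
rewrite /symm_sum; under eq_integral do rewrite EFinD -mulrN.
rewrite ge0_integralD; [|by []|by move=> g _; exact: norm_powR_ge0
  |exact: measurable_norm_powR_affine|by move=> g _; exact: norm_powR_ge0|]; last first.
  by under eq_fun do rewrite mulrN -mulNr; exact: measurable_norm_powR_affine.
have -> : \int[gauss]_g (`|z + b * - g| `^ p)%:E = \int[gauss]_g (`|z + b * g| `^ p)%:E.
  apply: (ge0_integral_normalN (measurable_norm_powR_affine z b)).
  by move=> g; exact: norm_powR_ge0.
by rewrite -smooth_EFin -EFinD mulr_natl mulr2n.
Qed.

Lemma gauss23_fin : gauss `[2%R, 3%R]%classic \is a fin_num.
Proof. exact: fin_num_measure. Qed.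

(** At s = b g the tangent term is m (g^2 - 1), which has Gaussian mean 0; what survives is the
    surplus [c] on the event 2 <= g <= 3. *)
Lemma smooth_gap z b c : (0 < b)%R -> (0 <= c)%R ->
  (forall g, 2 <= g <= 3 -> symm_sum p z b +
     tangent_slope p z b * ((b * g) ^+ 2 - b ^+ 2) + c <= symm_sum p z (b * g))%R ->
  (symm_sum p z b + c * fine (gauss `[2%R, 3%R]%classic) <= 2 * smooth b z)%R.
Proof.
move=> b0 c0 gap; set m := (tangent_slope p z b * b ^+ 2)%R.
have m0 : (0 <= m)%R by rewrite mulr_ge0 ?exprn_ge0 ?(ltW b0)// tangent_slope_ge0.
have S0 := symm_sum_ge0 z b.
have msq : measurable_fun [set: R] (fun x => (x ^+ 2)%:E) by apply/measurable_EFinP.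
pose J : R -> R := \1_(`[2%R, 3%R]%classic : set R).
have mi : measurable_fun [set: R] (fun x => (J x)%:E).
  by apply/measurable_EFinP; apply: measurable_indic; exact: measurable_itv.
have mm : measurable_fun [set: R] (fun g => m%:E * (g ^+ 2)%:E).
  exact: emeasurable_funM.
have mc : measurable_fun [set: R] (fun g => c%:E * (J g)%:E).
  exact: emeasurable_funM.
have cst0 : measurable_fun [set: R] (fun _ : R => (symm_sum p z b)%:E) by [].
have sq0 g : [set: R] g -> 0 <= (g ^+ 2)%:E by rewrite lee_fin sqr_ge0.
have i0 g : [set: R] g -> 0 <= (J g)%:E by move=> _; rewrite lee_fin /J indicE.
have m0' g : [set: R] g -> 0 <= m%:E * (g ^+ 2)%:E.
  by move=> _; rewrite -EFinM lee_fin mulr_ge0// sqr_ge0.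
have c0' g : [set: R] g -> 0 <= c%:E * (J g)%:E.
  by move=> _; rewrite -EFinM lee_fin mulr_ge0.
(* The negative part of the tangent term stands on the right as [m], so that both integrands are
   nonnegative. *)
have : \int[gauss]_g ((symm_sum p z b)%:E + m%:E * (g ^+ 2)%:E +
    c%:E * (J g)%:E) <=
    \int[gauss]_g ((symm_sum p z (b * g))%:E + m%:E).
  apply: ge0_le_integral.
  - by [].
  - move=> g _; apply: adde_ge0; last exact: c0'.
    by apply: adde_ge0; [rewrite lee_fin|exact: m0'].
  - by apply: emeasurable_funD; [exact: emeasurable_funD|].
  - by apply: emeasurable_funD => //; exact: measurable_symm_sum.
  - move=> g _; rewrite -!EFinM -!EFinD lee_fin /J indicE.
    have e : (tangent_slope p z b * ((b * g) ^+ 2 - b ^+ 2) = m * g ^+ 2 - m)%R.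
      by rewrite /m; ring.
    have [gin|gin] := boolP (g \in _).
      have := gap g; rewrite e; move: gin; rewrite inE/= in_itv/= => gin /(_ gin).
      by rewrite mulr1; lra.
    rewrite mulr0 addr0.
    by have := symm_sum_tangent_le p_ge3 z (b * g)%R b0; rewrite e; lra.
rewrite ge0_integralD; [|by []| |exact: emeasurable_funD|exact: c0'|exact: mc]; last first.
  by move=> g _; apply: adde_ge0; [rewrite lee_fin|exact: m0'].
rewrite ge0_integralD; [|by []|by move=> g _; rewrite lee_fin|by []|exact: m0'|exact: mm].
rewrite [in X in _ <= X]ge0_integralD; [|by []|by move=> g _; rewrite lee_fin symm_sum_ge0
  |exact: measurable_symm_sum|by move=> g _; rewrite lee_fin|exact: measurable_cst].
rewrite integral_symm_sum !integral_cst//= probability_setT !mule1.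
rewrite (ge0_integralZl_EFin gauss measurableT sq0 msq m0) gauss_second_moment mule1.
rewrite (ge0_integralZl_EFin gauss measurableT i0 mi c0) /J integral_indic//= setIT.
rewrite -(fineK gauss23_fin) -EFinM -!EFinD lee_fin [fine (fine _)%:E]/=.
by lra.
Qed.

Lemma symm_sum_le_smooth z a : (0 <= a)%R -> (symm_sum p z a <= 2 * smooth a z)%R.
Proof.
rewrite le_eqVlt => /orP[/eqP<-|a0].
  by rewrite smooth0 /symm_sum addr0 subr0 mulr_natl.
have := @smooth_gap z a 0 a0 (lexx _); rewrite mul0r addr0; apply => g _.
by rewrite addr0; exact: symm_sum_tangent_le.
Qed.

Lemma smooth_symm_sum s x a :
  \int[gauss]_h (symm_sum p (x + s * h) a)%:E = (smooth s (x + a) + smooth s (x - a))%:E.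
Proof.
rewrite EFinD !smooth_EFin /symm_sum; under eq_integral do rewrite EFinD.
have e1 h : (x + s * h + a = (x + a) + s * h)%R by ring.
have e2 h : (x + s * h - a = (x - a) + s * h)%R by ring.
under eq_integral do rewrite e1 e2.
rewrite ge0_integralD; [by []|by []|by move=> g _; exact: norm_powR_ge0
  |exact: measurable_norm_powR_affine|by move=> g _; exact: norm_powR_ge0
  |exact: measurable_norm_powR_affine].
Qed.

Lemma measurable_symm_sum_affine s x a :
  measurable_fun [set: R] (fun h => (symm_sum p (x + s * h) a)%:E).
Proof.
rewrite /symm_sum; under eq_fun do rewrite EFinD.
apply: emeasurable_funD.
  have -> : (fun h => (`|x + s * h + a| `^ p)%:E) = (fun h => (`|(x + a) + s * h| `^ p)%:E).
    by apply/funext => h; congr ((`|_| `^ _)%:E); ring.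
  exact: measurable_norm_powR_affine.
have -> : (fun h => (`|x + s * h - a| `^ p)%:E) = (fun h => (`|(x - a) + s * h| `^ p)%:E).
  by apply/funext => h; congr ((`|_| `^ _)%:E); ring.
exact: measurable_norm_powR_affine.
Qed.

Lemma smooth_swap_le s a x : (0 <= s)%R -> (0 <= a)%R ->
  ((smooth s (x + a) + smooth s (x - a)) / 2 <= smooth (Num.sqrt (s ^+ 2 + a ^+ 2)) x)%R.
Proof.
move=> s0 a0; rewrite ler_pdivrMr// mulrC -lee_fin EFinM -smooth_semigroup//.
rewrite -(smooth_symm_sum s x a) -ge0_integralZl_EFin; [|by []
  |by move=> h _; rewrite lee_fin smooth_ge0|exact: measurable_smooth_affine|by []].
apply: ge0_le_integral.
- by [].
- by move=> h _; rewrite lee_fin symm_sum_ge0.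
- exact: measurable_symm_sum_affine.
- by apply: emeasurable_funM => //; exact: measurable_smooth_affine.
- by move=> h _; rewrite -EFinM lee_fin; exact: symm_sum_le_smooth.
Qed.

(** This is the splitting of a sign with coefficient a = sqrt 2 b into two signs with coefficient
    [b], whose sum is 2 b, 0, 0 or -2 b. The tangent bound at a is used at 2 b and at 0: as a^2 is
    the mean of (2 b)^2 and 0, the slopes cancel. *)
Lemma smooth_double_le s b x : (0 <= b)%R ->
  ((smooth s (x + Num.sqrt 2 * b) + smooth s (x - Num.sqrt 2 * b)) / 2 <=
   (smooth s (x + 2 * b) + 2 * smooth s x + smooth s (x - 2 * b)) / 4)%R.
Proof.
have r2 : (0 < Num.sqrt 2 :> R)%R by rewrite sqrtr_gt0.
rewrite le_eqVlt => /orP[/eqP<-|b0].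
  by rewrite !mulr0 !addr0 !subr0; lra.
set a := (Num.sqrt 2 * b)%R.
have a0 : (0 < a)%R by rewrite mulr_gt0.
have a2 : (a ^+ 2 = 2 * b ^+ 2)%R by rewrite exprMn sqr_sqrtr.
have pt z : (2 * symm_sum p z a <= symm_sum p z (2 * b) + 2 * `|z| `^ p)%R.
  have h1 := symm_sum_tangent_le p_ge3 z (2 * b)%R a0.
  have h2 := symm_sum_tangent_le p_ge3 z 0%R a0.
  have z0 : (symm_sum p z 0 = 2 * `|z| `^ p)%R.
    by rewrite /symm_sum addr0 subr0 mulr_natl.
  have e : ((2 * b) ^+ 2 - a ^+ 2 = a ^+ 2)%R by rewrite a2; ring.
  by rewrite z0 e expr0n/= sub0r mulrN in h1 h2; lra.
have E (u u' v v' w : R) : (2 * (u + u') <= (v + v') + 2 * w ->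
    (u + u') / 2 <= (v + 2 * w + v') / 4)%R by lra.
apply: E; rewrite -lee_fin EFinD !EFinM.
rewrite -(smooth_symm_sum s x a) -(smooth_symm_sum s x (2 * b)%R) (smooth_EFin s x).
rewrite -!ge0_integralZl_EFin; [|by []|by move=> h _; exact: norm_powR_ge0
  |exact: measurable_norm_powR_affine|by []|by []
  |by move=> h _; rewrite lee_fin symm_sum_ge0|exact: measurable_symm_sum_affine|by []].
rewrite -ge0_integralD; [|by []|by move=> h _; rewrite lee_fin symm_sum_ge0
  |exact: measurable_symm_sum_affine
  |by move=> h _; rewrite mule_ge0// norm_powR_ge0
  |by apply: emeasurable_funM => //; exact: measurable_norm_powR_affine].
apply: ge0_le_integral.
- by [].
- by move=> h _; rewrite -EFinM lee_fin mulr_ge0// symm_sum_ge0.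
- by apply: emeasurable_funM => //; exact: measurable_symm_sum_affine.
- apply: emeasurable_funD; first exact: measurable_symm_sum_affine.
  by apply: emeasurable_funM => //; exact: measurable_norm_powR_affine.
- by move=> h _; rewrite -!EFinM -EFinD lee_fin.
Qed.

End smoothing.

#[local] Opaque smooth.

(** * Second-order expansion of the Gaussian kernel in its variance *)

Section kernel_expansion.
Context {R : realType}.
Implicit Types (u v w x y s a k : R).

(** The right-hand side minus 2 is the square of exp(w / 2) - exp(-w / 2), and that difference is at
    least w when w >= 0. *)
Lemma coshR_ge w : 2 + w ^+ 2 <= expR w + expR (- w).
Proof.
have sinh v : 0 <= v -> 2 * v <= expR v - expR (- v).
  move=> v0; rewrite -subr_ge0.
  pose F (x : R) := expR x - expR (- x) - 2 * x.
  have F0 : F 0 = 0 by rewrite /F oppr0 subrr mulr0 subrr.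
  have dF (x : R) : is_derive x 1 F (expR x + expR (- x) - 2).
    have h := @is_derive1_comp R (@expR R) -%R x _ _ (is_derive_expR (- x)) (is_deriveNid x 1).
    have h2 : is_derive x 1 F _ := is_deriveB (is_deriveB (is_derive_expR x) h)
      (is_deriveZ 2 (is_derive_id x (1 : R))).
    by apply: is_derive_eq h2 _; rewrite /GRing.scale/=; ring.
  rewrite -[leLHS]F0.
  apply: (@derive_ge0_le R F _ 0 v v0 (fun x _ => dF x)) => x _.
  have := expR_ge1Dx x; have := expR_ge1Dx (- x); lra.
wlog w0 : w / 0 <= w.
  move=> H; have [|w0] := leP 0 w; first exact: H.
  have := H (- w); rewrite sqrrN opprK addrC [expR w + _]addrC => -> //.
  by rewrite oppr_ge0 ltW.
have h := sinh (w / 2); rewrite divr_ge0// in h.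
have {h} := h isT.
have e1 : expR w = expR (w / 2) ^+ 2.
  by rewrite -expRM_natr; congr expR; field.
have e2 : expR (- w) = expR (- (w / 2)) ^+ 2.
  by rewrite -expRM_natr; congr expR; field.
have e3 : expR (w / 2) * expR (- (w / 2)) = 1 by exact: expRxMexpNx_1.
rewrite e1 e2.
move: e3; set X := expR _; set Y := expR _ => e3 h.
have -> : 2 + w ^+ 2 = 2 + (2 * (w / 2)) ^+ 2 by field.
have -> : X ^+ 2 + Y ^+ 2 = 2 + (X - Y) ^+ 2 by rewrite sqrrB e3; ring.
by rewrite lerD2l ler_sqr ?nnegrE; lra.
Qed.

Lemma expR_le_quadratic v : 0 <= v -> expR v <= 1 + v + v ^+ 2 * expR v.
Proof.
move=> v0.
have h : expR v <= 1 + v * expR v.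
  have h1 := expR_ge1Dx (- v).
  have : (1 - v) * expR v <= expR (- v) * expR v.
    by rewrite ler_wpM2r ?expR_ge0.
  by rewrite [X in _ <= X]mulrC expRxMexpNx_1 mulrBl mul1r; lra.
have : v * expR v <= v * (1 + v * expR v) by rewrite ler_wpM2l.
by set E := expR v in h *; rewrite mulrDr mulr1 mulrA -expr2; lra.
Qed.

Lemma sqrt1D_inv_le a : 0 <= a <= 1 ->
  (Num.sqrt (1 + a))^-1 <= 1 - a / 2 + 3 / 8 * a ^+ 2.
Proof.
move=> /andP[a0 a1].
have s0 : 0 < Num.sqrt (1 + a) by rewrite sqrtr_gt0; lra.
set b := 1 - a / 2 + 3 / 8 * a ^+ 2.
have b0 : 0 <= b.
  have : 0 <= a ^+ 2 by rewrite sqr_ge0.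
  by rewrite /b; lra.
rewrite -[leLHS]mul1r ler_pdivrMr//.
have E : (b * Num.sqrt (1 + a)) ^+ 2 = 1 + a ^+ 3 * (5 / 8 - 15 / 64 * a + 9 / 64 * a ^+ 2).
  by rewrite exprMn sqr_sqrtr; [rewrite /b; field|lra].
rewrite -ler_sqr ?nnegrE ?mulr_ge0 ?(ltW s0)// E expr1n lerDl mulr_ge0 ?exprn_ge0//.
have : 0 <= a ^+ 2 by rewrite sqr_ge0.
lra.
Qed.

(* Second-order comparison of the Gaussian kernel of variance [1 + a] with the
   average of two translates of the kernel of variance 1, where
   [u = z ^+ 2 / 2] and [w = z * sqrt a]. *)
Lemma gauss_kernel_expansion u a w : 0 <= u -> 0 <= a <= 2^-1 -> w ^+ 2 = 2 * u * a ->
  (Num.sqrt (1 + a))^-1 * expR (- (u / (1 + a))) <=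
  expR (- u) * expR (- (a / 2)) * ((expR w + expR (- w)) / 2) +
  36 * a ^+ 2 * expR (- (u / 4)).
Proof.
move=> u0 /andP[a0 a1] w2.
set v := u * a / (1 + a).
have a10 : 0 < 1 + a by lra.
have ua0 : 0 <= u * a by rewrite mulr_ge0.
have v0 : 0 <= v by rewrite divr_ge0// ltW.
have vua : v <= u * a by rewrite ler_pdivrMr// ler_peMr//; lra.
have vu : v <= u / 2.
  by apply: (le_trans vua); rewrite ler_wpM2l//; lra.
have -> : - (u / (1 + a)) = - u + v by rewrite /v; field; rewrite gt_eqF.
rewrite expRD.
(* As v is at most both u a and u / 2, the quadratic remainder of exp v is of order a^2 and keeps
   half of the Gaussian decay. *)
have h1 : expR (- u) * expR v <= expR (- u) * (1 + u * a) + a ^+ 2 * (u ^+ 2 * expR (- (u / 2))).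
  apply: (@le_trans _ _ (expR (- u) * (1 + v) + v ^+ 2 * expR (- u + v))).
    have := expR_le_quadratic v0; rewrite expRD => h.
    have : expR (- u) * expR v <= expR (- u) * (1 + v + v ^+ 2 * expR v).
      by rewrite ler_wpM2l ?expR_ge0.
    by rewrite [v ^+ 2 * (_ * _)]mulrCA -mulrDr.
  apply: lerD; first by rewrite ler_wpM2l ?expR_ge0// lerD2l.
  rewrite mulrA; apply: ler_pM; rewrite ?sqr_ge0 ?expR_ge0//.
    by rewrite -exprMn [a * u]mulrC ler_sqr ?nnegrE.
  by rewrite ler_expR; lra.
have a01 : 0 <= a <= 1 by rewrite a0/=; lra.
have h2 := sqrt1D_inv_le a01.
have h3 : 1 + u * a <= (expR w + expR (- w)) / 2.
  by have := coshR_ge w; rewrite w2; lra.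
have h4 : 1 - a / 2 <= expR (- (a / 2)) by have := expR_ge1Dx (- (a / 2)); lra.
have h5 : (1 + u) * expR (- u) <= 4 * expR (- (u / 4)).
  have -> : expR (- u) = expR (- (u / 4)) * expR (- (3 * u / 4)).
    by rewrite -expRD; congr expR; field.
  rewrite mulrCA mulrC; apply: ler_wpM2r; first exact: expR_ge0.
  rewrite -ler_pdivlMr ?expR_gt0// -expRN opprK.
  have := expR_ge1Dx (3 * u / 4); lra.
have h6 : u ^+ 2 * expR (- (u / 2)) <= 32 * expR (- (u / 4)).
  have -> : expR (- (u / 2)) = expR (- (u / 4)) * expR (- (u / 4)).
    by rewrite -expRD; congr expR; field.
  rewrite mulrA; apply: ler_wpM2r; first exact: expR_ge0.
  rewrite -ler_pdivlMr ?expR_gt0// -expRN opprK.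
  have u40 : 0 <= u / 4 by rewrite divr_ge0.
  have f2 : (2`!)%:R = 2 :> R by [].
  have := expR_ge1Dxn 1 u40; rewrite f2; set e := expR _; lra.
set E := expR (- u) in h1 h5 *; set E4 := expR (- (u / 4)) in h5 h6 *.
set E2 := u ^+ 2 * _ in h1 h6; set V := expR v in h1 *.
set C := (_ / 2) in h3 *; set Q := expR (- (a / 2)) in h4 *.
set S := _^-1 in h2 *.
have E0 : 0 <= E by exact: expR_ge0.
have E20 : 0 <= E2 by rewrite mulr_ge0 ?sqr_ge0 ?expR_ge0.
have E40 : 0 <= E4 by exact: expR_ge0.
have a20 : 0 <= a ^+ 2 by exact: sqr_ge0.
have S0 : 0 <= S by rewrite invr_ge0 sqrtr_ge0.
have EV0 : 0 <= E * V by rewrite mulr_ge0 ?expR_ge0.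
have uaa : u * a <= u by rewrite ler_piMr//; lra.
(* The main part (1 - a / 2) (1 + u a) is absorbed by [h4] and [h3]; the remainder is at most (3 / 8
   * 4 + 32) a^2 [E4], and 36 is a round bound. *)
apply: (@le_trans _ _ ((1 - a / 2 + 3 / 8 * a ^+ 2) * (E * (1 + u * a) + a ^+ 2 * E2))).
  exact: ler_pM.
have -> : (1 - a / 2 + 3 / 8 * a ^+ 2) * (E * (1 + u * a) + a ^+ 2 * E2) =
  E * ((1 - a / 2) * (1 + u * a)) + a ^+ 2 * (3 / 8 * (E * (1 + u * a)) +
    (1 - a / 2 + 3 / 8 * a ^+ 2) * E2) by ring.
apply: lerD.
  rewrite -mulrA ler_wpM2l//; apply: ler_pM => //; first lra.
  by rewrite addr_ge0.
rewrite [leRHS]mulrAC [leRHS]mulrC; apply: ler_wpM2l => //.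
have k1 : E * (1 + u * a) <= 4 * E4.
  by apply: le_trans h5; rewrite mulrC ler_wpM2r//; lra.
have k2 : (1 - a / 2 + 3 / 8 * a ^+ 2) * E2 <= 1 * E2.
  rewrite ler_wpM2r//.
  have : a ^+ 2 <= a * 2^-1 by rewrite expr2 ler_wpM2l.
  by lra.
lra.
Qed.

(** The error exp(-u / 4) of [gauss_kernel_expansion] is, up to normalisation, the kernel of
    deviation [2 * s]; its peak is half as high, which turns 36 into 72. *)
Lemma normal_pdf_expansion x y s a : 0 < s -> 0 <= a -> a ^+ 2 <= s ^+ 2 / 2 ->
  normal_pdf x (Num.sqrt (s ^+ 2 + a ^+ 2)) y <=
  2^-1 * normal_pdf (x + a) s y + 2^-1 * normal_pdf (x - a) s y +
  72 * (a ^+ 2 / s ^+ 2) ^+ 2 * normal_pdf x (2 * s) y.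
Proof.
move=> s0 a0 as2; set c := Num.sqrt _.
have s20 : 0 < s ^+ 2 by rewrite exprn_gt0.
have a20 : 0 <= a ^+ 2 by rewrite exprn_ge0.
have c0 : 0 < c by rewrite sqrtr_gt0; lra.
have c2 : c ^+ 2 = s ^+ 2 + a ^+ 2 by rewrite sqr_sqrtr//; lra.
have s2 : 0 < 2 * s by lra.
set al := a ^+ 2 / s ^+ 2.
have al0 : 0 <= al <= 2^-1.
  apply/andP; split; first by rewrite divr_ge0// ltW.
  by rewrite ler_pdivrMr// mulrC.
pose z := y - x; pose u := z ^+ 2 / (2 * s ^+ 2); pose w := z * a / s ^+ 2.
have u0 : 0 <= u by rewrite divr_ge0 ?sqr_ge0//; lra.
have w2 : w ^+ 2 = 2 * u * al.
  by rewrite /w /u /al; field; rewrite gt_eqF.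
have cE : c = s * Num.sqrt (1 + al).
  rewrite /c (_ : s ^+ 2 + a ^+ 2 = s ^+ 2 * (1 + al)).
    by rewrite sqrtrM ?(ltW s20)// sqrtr_sqr gtr0_norm.
  by rewrite /al; field; rewrite gt_eqF.
have := gauss_kernel_expansion u0 al0 w2.
rewrite !normal_pdfE ?gt_eqF// !normal_peak_gt0E// /normal_fun.
set k := (Num.sqrt (pi *+ 2))^-1.
have k0 : 0 <= k by rewrite invr_ge0 sqrtr_ge0.
have al1 : 0 < 1 + al by lra.
have e0 : - (y - x) ^+ 2 / (c ^+ 2 *+ 2) = - (u / (1 + al)).
  rewrite c2 /u /al /z; field.
  by rewrite !gt_eqF//; lra.
have e1 : - (y - (x + a)) ^+ 2 / (s ^+ 2 *+ 2) = - u + - (al / 2) + w.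
  by rewrite /u /al /w /z; field; rewrite gt_eqF.
have e2 : - (y - (x - a)) ^+ 2 / (s ^+ 2 *+ 2) = - u + - (al / 2) + - w.
  by rewrite /u /al /w /z; field; rewrite gt_eqF.
have e3 : - (y - x) ^+ 2 / ((2 * s) ^+ 2 *+ 2) = - (u / 4).
  by rewrite /u /z; field; rewrite gt_eqF.
rewrite e0 e1 e2 e3 !expRD cE !invfM.
set S := (Num.sqrt _)^-1; set E0 := expR _; set E1 := expR (- u); set E2 := expR (- (al / 2)).
set W := expR w; set W' := expR (- w); set E4 := expR _ => h.
have sk0 : 0 <= s^-1 * k by rewrite mulr_ge0// invr_ge0 ltW.
have := ler_wpM2l sk0 h.
have -> : s^-1 * S * k * E0 = s^-1 * k * (S * E0) by ring.
have -> : 2^-1 * (s^-1 * k * (E1 * E2 * W)) + 2^-1 * (s^-1 * k * (E1 * E2 * W')) +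
  72 * al ^+ 2 * (2^-1 * s^-1 * k * E4) =
  s^-1 * k * (E1 * E2 * ((W + W') / 2) + 36 * al ^+ 2 * E4) by field; rewrite gt_eqF.
by [].
Qed.

(** On the interval |y - x| <= 8 and s^2 >= 1/4, so the exponent (y - x)^2 / (2 s^2) is at most 64 /
    (1/2) = 128. *)
Lemma normal_prob_itv_ge x s l u : 2^-1 <= s <= 1 -> `|x| <= 2 ->
  -6 <= l -> l <= u -> u <= 6 ->
  (((Num.sqrt (pi *+ 2))^-1 * expR (- 128) * (u - l))%:E <= normal_prob x s `[l, u]%classic)%E.
Proof.
move=> /andP[s2 s1]; rewrite ler_norml => /andP[x1 x2] l6 lu u6.
have s0 : 0 < s by lra.
set k := (Num.sqrt (pi *+ 2))^-1.
have k0 : 0 <= k by rewrite invr_ge0 sqrtr_ge0.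
rewrite /normal_prob.
have -> : ((k * expR (- 128) * (u - l))%:E =
    \int[lebesgue_measure]_(y in `[l, u]%classic) (k * expR (- 128))%:E)%E.
  rewrite integral_cst; last exact: measurable_itv.
  rewrite /= lebesgue_measure_itv/= lte_fin; case: ifPn => [_|].
    by rewrite -EFinD -EFinM.
  rewrite -leNgt => ul; have -> : u = l by apply/le_anti; rewrite ul lu.
  by rewrite subrr mulr0 mule0.
apply: ge0_le_integral.
- exact: measurable_itv.
- by move=> y _; rewrite lee_fin mulr_ge0// expR_ge0.
- exact: measurable_cst.
- by apply/measurable_EFinP; apply: measurable_funTS; exact: measurable_normal_pdf.
- move=> y /=; rewrite in_itv/= => /andP[ly yu]; rewrite lee_fin.
  rewrite normal_pdfE ?gt_eqF// normal_peak_gt0E// -/k; apply: ler_pM => //.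
  + by rewrite ler_peMl// invf_ge1.
  + rewrite ler_expR mulNr lerN2 ler_pdivrMr; last first.
      by rewrite pmulrn_lgt0// exprn_gt0.
    have h1 : (y - x) ^+ 2 <= 64.
      have : 0 <= (8 - (y - x)) * (8 + (y - x)) by rewrite mulr_ge0//; lra.
      by lra.
    have h2 : 4^-1 <= s ^+ 2.
      have : 0 <= (s - 2^-1) * (s + 2^-1) by rewrite mulr_ge0//; lra.
      by lra.
    by rewrite -mulr_natr; lra.
Qed.
End kernel_expansion.

#[local] Opaque smooth.

(** * Gain and loss when one sign is replaced by a Gaussian *)

Section smooth_swap.
Context {R : realType} (p : R).
Hypothesis p_ge3 : 3 <= p.
Local Open Scope ereal_scope.
Implicit Types (x y z s a b c g l u : R).
Local Notation mu := (@lebesgue_measure R).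
Local Notation gauss := (@normal_prob R 0 1).
Local Notation smooth := (smooth p).

(** The surplus c of [symm_sum_gap] is collected when the replacing Gaussian lies in [2, 3], of
    probability [q], and x + s G in the window [l, u], of probability at least d (u - l). As c (u -
    l) >= k b^4, the gain is k q d b^4, halved because [symm_sum] is twice an average. *)
Lemma smooth_swap_gap : exists2 k : R, (0 < k)%R & forall s b x,
  (2^-1 <= s <= 1)%R -> (0 <= b <= 1)%R -> (`|x| <= 2)%R ->
  ((smooth s (x + b) + smooth s (x - b)) / 2 + k * b ^+ 4 <=
    smooth (Num.sqrt (s ^+ 2 + b ^+ 2)) x)%R.
Proof.
have p3 := p_ge3.
have [k k0 hk] := symm_sum_gap p_ge3.
set d := ((Num.sqrt (pi *+ 2))^-1 * expR (- 128) : R)%R.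
have d0 : (0 < d)%R.
  by rewrite mulr_gt0 ?expR_gt0// invr_gt0 sqrtr_gt0 pmulrn_lgt0// pi_gt0.
set q := fine (gauss `[2%R, 3%R]%classic).
have q0 : (0 < q)%R.
  have h11 : (2^-1 <= (1 : R) <= 1)%R by lra.
  have h00 : (`|0 : R| <= 2)%R by rewrite normr0.
  have h1 : (-6 <= (2 : R))%R by lra.
  have h2 : ((2 : R) <= 3)%R by lra.
  have h3 : ((3 : R) <= 6)%R by lra.
  have := normal_prob_itv_ge h11 h00 h1 h2 h3.
  rewrite -/d -(fineK gauss23_fin) -/q lee_fin => h.
  have h4 : (0 < (3 : R) - 2)%R by lra.
  by apply: lt_le_trans h; exact: mulr_gt0.
have kqd : (0 < k * q * d)%R := mulr_gt0 (mulr_gt0 k0 q0) d0.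
have kqd2 : (0 < k * q * d / 2)%R by move: kqd; generalize (k * q * d)%R => e; lra.
exists (k * q * d / 2)%R => //.
move=> s b x s12 /andP[+ b1] x2; have /andP[s2 s1] := s12.
have s0 : (0 < s)%R by lra.
rewrite le_eqVlt => /orP[/eqP<-|b0].
  rewrite addr0 subr0 !expr0n/= mulr0 !addr0 sqrtr_sqr gtr0_norm//.
  have E (v : R) : ((v + v) / 2 <= v)%R by lra.
  exact: E.
have b01 : (0 < b <= 1)%R by rewrite b0.
have [l [u [c [l6 lu u6 c0 [cg gap]]]]] := hk b b01.
pose J : R -> R := \1_(`[l, u]%classic : set R).
have pt z : (symm_sum p z b + c * q * J z <= 2 * smooth b z)%R.
  rewrite /J indicE; have [zin|zin] := boolP (z \in _); last first.
    rewrite mulr0 addr0; apply: symm_sum_le_smooth => //; exact: ltW.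
  rewrite mulr1; apply: smooth_gap => // g g23; apply: gap => //.
  by move: zin; rewrite inE/= in_itv.
have cq0 : (0 <= c * q)%R by rewrite mulr_ge0// ltW.
have mJ : measurable_fun [set: R] (fun z => (J z)%:E).
  by apply/measurable_EFinP; apply: measurable_indic; exact: measurable_itv.
have J0 z : 0 <= (J z)%:E by rewrite lee_fin /J indicE.
have mJs : measurable_fun [set: R] (fun h => (J (x + s * h))%:E).
  exact: (measurableT_comp mJ (measurable_affine x s)).
have : \int[gauss]_h ((symm_sum p (x + s * h) b)%:E + (c * q)%:E * (J (x + s * h))%:E) <=
    \int[gauss]_h (2%:E * (smooth b (x + s * h))%:E).
  apply: ge0_le_integral.
  - by [].
  - move=> h _; apply: adde_ge0; first by rewrite lee_fin symm_sum_ge0.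
    by rewrite mule_ge0// lee_fin.
  - apply: emeasurable_funD; first exact: measurable_symm_sum_affine.
    exact: emeasurable_funM.
  - by apply: emeasurable_funM => //; exact: measurable_smooth_affine.
  - by move=> h _; rewrite -!EFinM -EFinD lee_fin.
rewrite ge0_integralZl_EFin; [|by []|by move=> h _; rewrite lee_fin smooth_ge0
  |exact: measurable_smooth_affine|by []].
rewrite ge0_integralD; [|by []|by move=> h _; rewrite lee_fin symm_sum_ge0
  |exact: measurable_symm_sum_affine|by move=> h _; rewrite mule_ge0// lee_fin
  |exact: emeasurable_funM].
rewrite ge0_integralZl_EFin; [|by []|by move=> h _; exact: J0|exact: mJs|by []].
rewrite (smooth_semigroup p_ge3 x (ltW s0) (ltW b0)) (smooth_symm_sum p_ge3).
have -> : \int[gauss]_h (J (x + s * h))%:E = normal_prob x s `[l, u]%classic.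
  have -> := ge0_integral_normal_affine x s0 mJ J0.
  by rewrite /J integral_indic ?setIT//; exact: measurable_itv.
have := normal_prob_itv_ge s12 x2 l6 lu u6.
have fin : normal_prob x s `[l, u]%classic \is a fin_num by exact: fin_num_measure.
rewrite -(fineK fin) -/d -!EFinM -EFinD !lee_fin.
set v := fine _; set A := smooth s _; set B := smooth s _; set S := smooth _ _.
have b40 : (0 <= b ^+ 4)%R by rewrite exprn_ge0// ltW.
move=> h1 h2.
have h3 : (k * q * d * b ^+ 4 <= c * q * v)%R.
  apply: (@le_trans _ _ (c * q * (d * (u - l)))%R); last by rewrite ler_wpM2l.
  have -> : (k * q * d * b ^+ 4 = q * d * (k * b ^+ 4))%R by ring.
  have -> : (c * q * (d * (u - l)) = q * d * (c * (u - l)))%R by ring.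
  by apply: ler_wpM2l cg; exact: mulr_ge0 (ltW q0) (ltW d0).
clearbody v A B S; lra.
Qed.

(** In this form pointwise comparisons of densities integrate to comparisons of [smooth]. *)
Lemma smooth_kernel s x : (0 < s)%R ->
  (smooth s x)%:E = \int[mu]_y ((`|y| `^ p)%:E * (normal_pdf x s y)%:E).
Proof.
move=> s0; rewrite (smooth_EFin p_ge3).
have h := ge0_integral_normal_affine x s0 (measurable_norm_powR p) (norm_powR_ge0 p).
apply: eq_trans h _.
exact: (ge0_integral_normal_prob x s (measurable_norm_powR p) (norm_powR_ge0 p)).
Qed.

Lemma smooth_swap_ge s a x : (0 < s)%R -> (0 <= a)%R -> (a ^+ 2 <= s ^+ 2 / 2)%R ->
  (smooth (Num.sqrt (s ^+ 2 + a ^+ 2)) x <= (smooth s (x + a) + smooth s (x - a)) / 2 +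
     72 * (a ^+ 2 / s ^+ 2) ^+ 2 * smooth (2 * s) x)%R.
Proof.
move=> s0 a0 as2.
have c0 : (0 < Num.sqrt (s ^+ 2 + a ^+ 2))%R.
  by rewrite sqrtr_gt0 ltr_pwDl ?exprn_gt0// sqr_ge0.
have s20 : (0 < 2 * s)%R by rewrite mulr_gt0.
set K := (72 * _)%R.
have K0 : (0 <= K)%R by rewrite mulr_ge0// sqr_ge0.
have mk m t : measurable_fun [set: R] (fun y => (`|y| `^ p)%:E * (normal_pdf m t y)%:E).
  apply: emeasurable_funM; first exact: measurable_norm_powR.
  by apply/measurable_EFinP; exact: measurable_normal_pdf.
have k0 m t y : 0 <= (`|y| `^ p)%:E * (normal_pdf m t y)%:E.
  by rewrite mule_ge0// ?norm_powR_ge0// lee_fin normal_pdf_ge0.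
have E (u u' v w : R) : (v <= 2^-1 * u + 2^-1 * u' + w -> v <= (u + u') / 2 + w)%R by lra.
apply: E; move: (smooth_kernel x c0) (smooth_kernel x s20).
move: (smooth_kernel (x + a)%R s0) (smooth_kernel (x - a)%R s0).
move: (smooth _ x) (smooth _ x) (smooth s (x + a)) (smooth s (x - a)).
move=> v w u u' hu hu' hv hw.
rewrite -lee_fin !EFinD !EFinM hv hw hu hu'.
have h0 : (0 <= 2^-1 :> R)%R by [].
rewrite -(ge0_integralZl_EFin mu measurableT (fun y _ => k0 (x + a)%R s y) (mk (x + a)%R s) h0).
rewrite -(ge0_integralZl_EFin mu measurableT (fun y _ => k0 (x - a)%R s y) (mk (x - a)%R s) h0).
rewrite -(ge0_integralZl_EFin mu measurableT (fun y _ => k0 x (2 * s)%R y) (mk x (2 * s)%R) K0).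
have t1 m y : [set: R] y -> 0 <= 2^-1%:E * ((`|y| `^ p)%:E * (normal_pdf m s y)%:E).
  by move=> _; apply: mule_ge0; [rewrite lee_fin|exact: k0].
have mt m : measurable_fun [set: R] (fun y => 2^-1%:E * ((`|y| `^ p)%:E * (normal_pdf m s y)%:E)).
  by apply: emeasurable_funM; [exact: measurable_cst|exact: mk].
rewrite -(ge0_integralD mu measurableT (t1 (x + a)%R) (mt (x + a)%R) (t1 (x - a)%R) (mt (x - a)%R)).
have t2 y : [set: R] y -> 0 <= K%:E * ((`|y| `^ p)%:E * (normal_pdf x (2 * s) y)%:E).
  by move=> _; apply: mule_ge0; [rewrite lee_fin|exact: k0].
have mt2 : measurable_fun [set: R] (fun y => K%:E * ((`|y| `^ p)%:E * (normal_pdf x (2 * s) y)%:E)).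
  by apply: emeasurable_funM; [exact: measurable_cst|exact: mk].
rewrite -ge0_integralD; [|by []| | |exact: t2|exact: mt2]; last first.
- by apply: emeasurable_funD; exact: mt.
- by move=> y _; apply: adde_ge0; exact: t1.
apply: ge0_le_integral.
- by [].
- by move=> y _; exact: k0.
- exact: mk.
- by apply: emeasurable_funD; [apply: emeasurable_funD; exact: mt|exact: mt2].
- move=> y _; rewrite -!EFinM -!EFinD lee_fin.
  have := normal_pdf_expansion x y s0 a0 as2; rewrite -/K.
  set A := normal_pdf x (Num.sqrt _) y; set B := normal_pdf (x + a)%R s y.
  set C := normal_pdf (x - a)%R s y; set D := normal_pdf x (2 * s)%R y => h.
  have -> : (2^-1 * (`|y| `^ p * B) + 2^-1 * (`|y| `^ p * C) + K * (`|y| `^ p * D) =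
    `|y| `^ p * (2^-1 * B + 2^-1 * C + K * D))%R by ring.
  by rewrite ler_wpM2l// powR_ge0.
Qed.

Lemma smooth_ndecr0 s s' : (0 <= s <= s')%R -> (smooth s 0 <= smooth s' 0)%R.
Proof.
have p3 := p_ge3.
move=> /andP[s0 ss']; rewrite -lee_fin !(smooth_EFin p_ge3).
apply: ge0_le_integral.
- by [].
- by move=> g _; exact: norm_powR_ge0.
- exact: measurable_norm_powR_affine.
- exact: measurable_norm_powR_affine.
- move=> g _; rewrite lee_fin !add0r !normrM.
  apply: ge0_ler_powR; rewrite ?nnegrE ?mulr_ge0//; first lra.
  by rewrite ler_wpM2r// !ger0_norm// (le_trans s0).
Qed.

Lemma powR1B_ge (e t : R) : (0 <= e)%R -> (0 <= t <= 2^-1)%R -> (1 - 2 * e * t <= (1 - t) `^ e)%R.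
Proof.
move=> e0 /andP[t0 t1].
have t10 : (0 < 1 - t)%R by lra.
have h : (- (2 * t) <= ln (1 - t))%R.
  have h1 : (ln (1 + t / (1 - t)) <= t / (1 - t))%R.
    by apply: le_ln1Dx; apply: (@lt_le_trans _ _ 0%R); rewrite ?oppr_lt0 ?divr_ge0//; lra.
  have h2 : (1 + t / (1 - t) = (1 - t)^-1)%R by field; rewrite gt_eqF.
  rewrite h2 lnV ?posrE// in h1.
  have : (t / (1 - t) <= 2 * t)%R.
    rewrite ler_pdivrMr//.
    have : (0 <= t * (2^-1 - t))%R by rewrite mulr_ge0//; lra.
    by lra.
  by lra.
rewrite /powR gt_eqF//; apply: le_trans (expR_ge1Dx _).
rewrite lerD2l -mulrN -mulrA mulrCA mulrN [leLHS](_ : _ = e * - (2 * t))%R; last by ring.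
by rewrite ler_wpM2l.
Qed.

(** This removes a small Gaussian part. Writing x + s g as the mixture of x / (1 - s) and g with
    weights 1 - s and s, convexity bounds [smooth s x] by (1 - s)^(1 - p) |x|^p + s E|G|^p; it
    remains to multiply by (1 - s)^(p - 1) >= 1 - 2 p s. *)
Lemma smooth_small_le s x : (0 < s <= 2^-1)%R ->
  ((1 - 2 * p * s) * smooth s x - s * smooth 1 0 <= `|x| `^ p)%R.
Proof.
have p3 := p_ge3.
move=> /andP[s0 s1].
have s10 : (0 < 1 - s)%R by lra.
have s10' : (1 - s != 0)%R by rewrite gt_eqF.
set A := ((1 - s) * `|x / (1 - s)| `^ p)%R.
have A0 : (0 <= A)%R by rewrite mulr_ge0 ?powR_ge0// ltW.
set rho := ((1 - s) `^ (p - 1))%R.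
have rho1 : (1 - 2 * p * s <= rho)%R.
  have e0 : (0 <= p - 1)%R by lra.
  have s01 : (0 <= s <= 2^-1)%R by lra.
  apply: le_trans (powR1B_ge e0 s01).
  have : (0 <= s)%R by lra.
  by lra.
have rho2 : (rho <= 1)%R.
  have := @ge0_ler_powR R (p - 1)%R _ (1 - s)%R 1%R; rewrite !nnegrE powR1; apply; lra.
have rho0 : (0 <= rho)%R by exact: powR_ge0.
have E : (rho * A = `|x| `^ p)%R.
  have e : ((1 - s) * `|x / (1 - s)| = `|x|)%R.
    by rewrite normrM normfV (gtr0_norm s10) mulrCA divff// mulr1.
  have p0 : (0 < p)%R by lra.
  rewrite /A /rho mulrA [(_ `^ _ * _)%R]mulrC mulr_powRB1 ?(ltW s10)//.
  by rewrite -powRM ?(ltW s10)// e.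
have h : (smooth s x <= A + s * smooth 1 0)%R.
  rewrite -lee_fin EFinD (EFinM s) !(smooth_EFin p_ge3).
  rewrite -ge0_integralZl_EFin; [|by []|by move=> g _; exact: norm_powR_ge0
    |exact: measurable_norm_powR_affine|exact: ltW].
  have -> : A%:E = \int[gauss]_g A%:E.
    by rewrite integral_cst//= probability_setT mule1.
  rewrite -ge0_integralD; [|by []|by move=> g _; rewrite lee_fin|by []
    |by move=> g _; rewrite mule_ge0 ?norm_powR_ge0// lee_fin ltW
    |by apply: emeasurable_funM; [exact: measurable_cst|exact: measurable_norm_powR_affine]].
  apply: ge0_le_integral.
  - by [].
  - by move=> g _; exact: norm_powR_ge0.
  - exact: measurable_norm_powR_affine.
  - apply: emeasurable_funD; first exact: measurable_cst.
    by apply: emeasurable_funM; [exact: measurable_cst|exact: measurable_norm_powR_affine].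
  - move=> g _; rewrite -EFinM -EFinD lee_fin add0r mul1r.
    have h01 : (0 <= 1 - s <= 1)%R by lra.
    have p1 : (1 <= p)%R by lra.
    have := norm_powR_convex (x / (1 - s))%R g p1 h01.
    have -> : ((1 - s) * (x / (1 - s)) + (1 - (1 - s)) * g = x + s * g)%R by field.
    by have -> : (1 - (1 - s) = s)%R by ring.
have S0 := smooth_ge0 p s x; have M0 := smooth_ge0 p 1 0.
move: h; set S := smooth s x; set M := smooth 1 0 => h.
apply: (@le_trans _ _ (rho * S - s * M)%R).
  by rewrite lerD2r ler_wpM2r.
rewrite -E lerBlDr.
apply: (@le_trans _ _ (rho * (A + s * M))%R); first by rewrite ler_wpM2l.
by rewrite mulrDr lerD2l ler_piMl// mulr_ge0// ltW.
Qed.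
End smooth_swap.

(** * Averages over signs *)

Section rademacher_average.
Context {R : realType}.
Implicit Types (L : seq R) (h : R -> R) (x a c : R).

(** The expectation of h at x plus a sum of independent signs weighted by [L]; with lists, signs are
    exchanged one at a time by induction. *)
Fixpoint radem L h x : R :=
  if L is a :: L' then (radem L' h (x + a) + radem L' h (x - a)) / 2 else h x.

Definition sumsq L : R := \sum_(a <- L) a ^+ 2.

Lemma sumsq_cons a L : sumsq (a :: L) = a ^+ 2 + sumsq L.
Proof. by rewrite /sumsq big_cons. Qed.

Lemma sumsq_ge0 L : 0 <= sumsq L.
Proof. by apply: sumr_ge0 => a _; exact: sqr_ge0. Qed.

Lemma sumsq_cat L1 L2 : sumsq (L1 ++ L2) = sumsq L1 + sumsq L2.
Proof. by rewrite /sumsq big_cat. Qed.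

Lemma le_radem L h h' x : (forall y, h y <= h' y) -> radem L h x <= radem L h' x.
Proof.
move=> hh; elim: L x => [|a L IH] x /=; first exact: hh.
by rewrite ler_pM2r// lerD.
Qed.

Lemma radem_cat L1 L2 h x : radem (L1 ++ L2) h x = radem L1 (radem L2 h) x.
Proof. by elim: L1 x => [|a L IH] x //=; rewrite !IH. Qed.

(** The head sign may also be averaged innermost, where it acts on [h] itself and [le_radem] can use
    a pointwise inequality. *)
Lemma radem_cons a L h x :
  radem (a :: L) h x = radem L (fun y => (h (y + a) + h (y - a)) / 2) x.
Proof.
rewrite /=; elim: L x => [|b L IH] x //=.
rewrite -!IH; set A := radem L h _; set B := radem L h _.
set C := radem L h _; set D := radem L h _.
have -> : A = radem L h (x + b + a) by rewrite /A addrAC.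
have -> : B = radem L h (x - b + a) by rewrite /B addrAC.
have -> : C = radem L h (x + b - a) by rewrite /C addrAC.
have -> : D = radem L h (x - b - a) by rewrite /D addrAC.
by field.
Qed.

Lemma radem_catC L1 L2 h x : radem (L1 ++ L2) h x = radem (L2 ++ L1) h x.
Proof.
rewrite [RHS]radem_cat; elim: L1 h x => [|a L IH] h x //.
rewrite [LHS]radem_cons IH; congr (radem L2 _ x).
by apply/funext => y; rewrite radem_cons.
Qed.

Lemma rademB L h h' c x : radem L (fun y => h y - c * h' y) x = radem L h x - c * radem L h' x.
Proof. by elim: L x => [|a L IH] x //=; rewrite !IH; field. Qed.

Lemma rademBc L h c c' x : radem L (fun y => c * h y - c') x = c * radem L h x - c'.
Proof. by elim: L x => [|a L IH] x //=; rewrite !IH; field. Qed.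

Lemma radem_sqr L x : radem L (fun y => y ^+ 2) x = x ^+ 2 + sumsq L.
Proof.
elim: L x => [|a L IH] x /=; first by rewrite /sumsq big_nil addr0.
by rewrite !IH sumsq_cons; field.
Qed.

Lemma radem_chebyshev L : 1 - sumsq L / 4 <= radem L (fun y => (if `|y| <= 2 then 1 else 0)) 0.
Proof.
(* The parabola 1 - y^2 / 4 lies below the indicator of |y| <= 2; it is written in the shape
   expected by [rademBc]. *)
have -> : 1 - sumsq L / 4 = radem L (fun y => - 4^-1 * y ^+ 2 - - 1) 0.
  by rewrite rademBc radem_sqr expr0n/= add0r; field.
apply: le_radem => y; case: (leP `|y| 2) => h /=.
  by have := sqr_ge0 y; lra.
have : 2 ^+ 2 <= `|y| ^+ 2 by rewrite ler_sqr ?nnegrE// ltW.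
by rewrite real_normK ?num_real//; lra.
Qed.
End rademacher_average.

#[local] Opaque smooth.

(** * Replacing the signs of a list by Gaussians *)

Section replacement.
Context {R : realType} (p : R).
Hypothesis p_ge3 : 3 <= p.
Implicit Types (L : seq R) (x y a b t : R).

(* [heat] is parametrised by the variance, [smooth] by the standard deviation. *)
Definition heat t x : R := smooth p (Num.sqrt t) x.

Lemma heatE t x : heat t x = smooth p (Num.sqrt t) x. Proof. by []. Qed.

#[local] Opaque heat.

Lemma heat_ge0 t x : 0 <= heat t x. Proof. by rewrite heatE; exact: smooth_ge0. Qed.

Lemma heat_swap_le t a x : 0 <= t -> 0 <= a ->
  (heat t (x + a) + heat t (x - a)) / 2 <= heat (t + a ^+ 2) x.
Proof.
move=> t0 a0; have := @smooth_swap_le R p p_ge3 (Num.sqrt t) a x (sqrtr_ge0 _) a0.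
by rewrite sqr_sqrtr// !heatE.
Qed.

Lemma radem_heat_le L t x : 0 <= t -> {in L, forall a, 0 <= a} ->
  radem L (heat t) x <= heat (t + sumsq L) x.
Proof.
elim: L t x => [|a L IH] t x t0 L0; first by rewrite /sumsq big_nil addr0.
have a0 : 0 <= a by apply: L0; rewrite mem_head.
have L0' : {in L, forall a, 0 <= a} by move=> b bL; apply: L0; rewrite inE bL orbT.
rewrite radem_cons; apply: (@le_trans _ _ (radem L (heat (t + a ^+ 2)) x)).
  by apply: le_radem => y; exact: heat_swap_le.
by rewrite sumsq_cons addrA; apply: IH => //; rewrite addr_ge0// sqr_ge0.
Qed.

(** After the splitting of [smooth_double_le], one of the two signs of size [b] is replaced, from
    each of the centres x + b and x - b. *)
Lemma heat_split_le t a b x : 0 <= t -> 0 <= b -> a = Num.sqrt 2 * b ->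
  (heat t (x + a) + heat t (x - a)) / 2 <=
  (heat (t + b ^+ 2) (x + b) + heat (t + b ^+ 2) (x - b)) / 2.
Proof.
move=> t0 b0 aE.
have := @smooth_double_le R p p_ge3 (Num.sqrt t) b x b0; rewrite -aE -!heatE.
have h1 := heat_swap_le (x + b) t0 b0; have h2 := heat_swap_le (x - b) t0 b0.
have e1 : x + b + b = x + 2 * b by ring.
have e2 : x - b - b = x - 2 * b by ring.
rewrite e1 addrK in h1; rewrite e2 subrK in h2.
move: h1 h2.
move: (heat t (x + 2 * b)) (heat t (x - 2 * b)) (heat t (x + a)) (heat t (x - a)).
move: (heat t x) (heat _ (x + b)) (heat _ (x - b)) => A B C D E F G.
lra.
Qed.

Lemma radem_heat_split L t x : 0 <= t -> {in L, forall a, 0 <= a} ->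
  radem L (heat t) x <=
  radem [seq a / Num.sqrt 2 | a <- L] (heat (t + sumsq L / 2)) x.
Proof.
elim: L t x => [|a L IH] t x t0 L0; first by rewrite /sumsq big_nil mul0r addr0.
have a0 : 0 <= a by apply: L0; rewrite mem_head.
have L0' : {in L, forall a, 0 <= a} by move=> b bL; apply: L0; rewrite inE bL orbT.
set b := a / Num.sqrt 2.
have b2 : b ^+ 2 = a ^+ 2 / 2 by rewrite expr_div_n sqr_sqrtr.
have r2 : 0 < Num.sqrt 2 :> R by rewrite sqrtr_gt0.
have b0 : 0 <= b by rewrite divr_ge0// ltW.
have aE : a = Num.sqrt 2 * b by rewrite /b mulrC divfK// gt_eqF.
rewrite radem_cons.
apply: (@le_trans _ _ (radem L (fun y => (heat (t + b ^+ 2) (y + b) +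
    heat (t + b ^+ 2) (y - b)) / 2) x)).
  by apply: le_radem => y; exact: heat_split_le.
have E : t + sumsq (a :: L) / 2 = t + b ^+ 2 + sumsq L / 2.
  by rewrite sumsq_cons b2; ring.
have t0' : 0 <= t + b ^+ 2 by rewrite addr_ge0// sqr_ge0.
have IHx y := IH (t + b ^+ 2) y t0' L0'.
rewrite E -(radem_cons b L (heat (t + b ^+ 2)) x) map_cons -/b.
move: (map _ L) IHx => L' IHx; move: (heat _) (heat _) IHx => h h' IHx.
by rewrite /= ler_pM2r// lerD.
Qed.

(** Each swap gains k b^4 where the remaining signs leave the sum in [-2, 2]; their variance is at
    most 1, so this has probability at least 3/4. The bounds 1/4 <= t <= 1 put the deviation in the
    range of [smooth_swap_gap]. *)
Lemma radem_heat_gap : exists2 k : R, 0 < k & forall L t, 4^-1 <= t ->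
  {in L, forall a, 0 <= a <= 1} -> t + sumsq L <= 1 ->
  radem L (heat t) 0 <= heat (t + sumsq L) 0 - k * \sum_(a <- L) a ^+ 4.
Proof.
have [k k0 hk] := smooth_swap_gap p_ge3.
exists (3 / 4 * k); first by lra.
elim=> [|b L IH] t t4 L01 tL.
  by rewrite /sumsq !big_nil addr0 mulr0 subr0.
have /andP[b0 b1] : 0 <= b <= 1 by apply: L01; rewrite mem_head.
have L01' : {in L, forall a, 0 <= a <= 1}.
  by move=> c cL; apply: L01; rewrite inE cL orbT.
have sL0 := sumsq_ge0 L; have b20 := sqr_ge0 b.
rewrite sumsq_cons in tL; rewrite sumsq_cons big_cons radem_cons.
have t0 : 0 <= t by lra.
have step y : (heat t (y + b) + heat t (y - b)) / 2 <=
    heat (t + b ^+ 2) y - k * b ^+ 4 * (if `|y| <= 2 then 1 else 0).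
  case: (leP `|y| 2) => h /=; last first.
    have := heat_swap_le y t0 b0; move: (heat _ _) (heat _ _) (heat _ _) => A B C.
    by rewrite mulr0 subr0.
  have s12 : 2^-1 <= Num.sqrt t <= 1.
    have e : 4^-1 = (2^-1 : R) ^+ 2 by field.
    apply/andP; split.
      rewrite -[leLHS](ger0_norm (_ : 0 <= 2^-1))// -sqrtr_sqr ler_sqrt//.
      by rewrite -e.
    by rewrite -[leRHS]sqrtr1 ler_sqrt//; lra.
  have b01 : 0 <= b <= 1 by rewrite b0.
  have := hk _ _ _ s12 b01 h; rewrite sqr_sqrtr// mulr1 -!heatE.
  by rewrite lerBrDr.
apply: (le_trans (le_radem _ _ step)); rewrite rademB.
have cheb := radem_chebyshev L.
have IHL := IH (t + b ^+ 2) _ L01' _.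
have {}IHL : radem L (heat (t + b ^+ 2)) 0 <=
  heat (t + b ^+ 2 + sumsq L) 0 - 3 / 4 * k * \sum_(a <- L) a ^+ 4 by apply: IHL; lra.
rewrite addrA mulrDr.
have kb : 0 <= k * b ^+ 4 by rewrite mulr_ge0 ?exprn_ge0// ltW.
have : k * b ^+ 4 * (3 / 4) <= k * b ^+ 4 * radem L (fun y => (if `|y| <= 2 then 1 else 0)) 0.
  by rewrite ler_wpM2l//; lra.
move: IHL; move: (radem L _ _) (radem L _ _) (heat _ _) (\sum_(a <- L) _) => A B C D.
lra.
Qed.

Lemma heat_swap_ge t a x : 0 < t -> 0 <= a -> a ^+ 2 <= t / 2 ->
  heat (t + a ^+ 2) x - 72 * (a ^+ 2 / t) ^+ 2 * heat (4 * t) x <=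
  (heat t (x + a) + heat t (x - a)) / 2.
Proof.
move=> t0 a0 at2.
have s0 : 0 < Num.sqrt t by rewrite sqrtr_gt0.
have := @smooth_swap_ge R p p_ge3 (Num.sqrt t) a x s0 a0.
rewrite sqr_sqrtr ?(ltW t0)// => /(_ at2).
have -> : 2 * Num.sqrt t = Num.sqrt (4 * t).
  by rewrite sqrtrM// (_ : 4 = 2 ^+ 2); [rewrite sqrtr_sqr ger0_norm|ring].
by rewrite -!heatE lerBlDr.
Qed.

Lemma heat0_ndecr t t' : 0 <= t -> t <= t' -> heat t 0 <= heat t' 0.
Proof.
move=> t0 tt; rewrite !heatE; apply: smooth_ndecr0 => //; rewrite sqrtr_ge0/=.
by rewrite ler_sqrt// (le_trans t0).
Qed.

(** [t0] is a floor for the variance, fixed throughout the pass over [L1], while the signs of [L2]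
    wait for a later pass. The error of a swap is [heat (4 * t)] averaged over the remaining signs;
    these are bounded by Gaussians in turn, and the resulting variance stays below 10. *)
Lemma radem_heat_ge L1 L2 t t0 : 0 < t0 -> t0 <= t ->
  {in L1 ++ L2, forall a, 0 <= a} -> {in L1, forall a, a ^+ 2 <= t0 / 2} ->
  t + sumsq L1 + sumsq L2 <= 2 ->
  radem L2 (heat (t + sumsq L1)) 0 -
    72 * (\sum_(a <- L1) a ^+ 4) / t0 ^+ 2 * heat 10 0 <=
  radem (L1 ++ L2) (heat t) 0.
Proof.
move=> t00.
have F (A B D G K : R) : G <= K -> A - D <= B -> A - (K + D) <= B - G by lra.
elim: L1 t => [|b L1 IH] t tt0 L0 L1t tL.
  by rewrite /sumsq !big_nil mulr0 !mul0r subr0 addr0.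
have b0 : 0 <= b by apply: L0; rewrite mem_head.
have L0' : {in L1 ++ L2, forall a, 0 <= a}.
  by move=> c cL; apply: L0; rewrite /= inE cL orbT.
have L1t' : {in L1, forall a, a ^+ 2 <= t0 / 2}.
  by move=> c cL; apply: L1t; rewrite inE cL orbT.
have b2 : b ^+ 2 <= t0 / 2 by apply: L1t; rewrite mem_head.
have b20 := sqr_ge0 b; have s10 := sumsq_ge0 L1; have s20 := sumsq_ge0 L2.
rewrite sumsq_cons in tL; rewrite sumsq_cons big_cons cat_cons radem_cons.
have tp : 0 < t by lra.
have bt : b ^+ 2 <= t / 2 by lra.
have v0 : t0 <= t + b ^+ 2 by lra.
have v1 : t + b ^+ 2 + sumsq L1 + sumsq L2 <= 2 by lra.
have t4 : 0 <= 4 * t by lra.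
have s0 := sumsq_ge0 (L1 ++ L2).
have u0 : 0 <= 4 * t + sumsq (L1 ++ L2) by lra.
have u1 : 4 * t + sumsq (L1 ++ L2) <= 10 by rewrite sumsq_cat; lra.
have E : 72 * (b ^+ 2 / t) ^+ 2 <= 72 * b ^+ 4 / t0 ^+ 2.
  rewrite -mulrA ler_pM2l// expr_div_n -exprM ler_wpM2l ?exprn_ge0//.
  by rewrite lef_pV2 ?posrE ?exprn_gt0// ler_sqr ?nnegrE; lra.
have step y : heat (t + b ^+ 2) y - 72 * (b ^+ 2 / t) ^+ 2 * heat (4 * t) y <=
  (heat t (y + b) + heat t (y - b)) / 2 by exact: heat_swap_ge.
apply: le_trans (le_radem (L1 ++ L2) 0 step); rewrite rademB addrA.
have IHt : radem L2 (heat (t + b ^+ 2 + sumsq L1)) 0 -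
    72 * (\sum_(a <- L1) a ^+ 4) / t0 ^+ 2 * heat 10 0 <=
    radem (L1 ++ L2) (heat (t + b ^+ 2)) 0.
  exact: IH v0 L0' L1t' v1.
have H : radem (L1 ++ L2) (heat (4 * t)) 0 <= heat 10 0.
  exact: le_trans (radem_heat_le 0 t4 L0') (heat0_ndecr u0 u1).
have E' : 72 * (b ^+ 2 / t) ^+ 2 * radem (L1 ++ L2) (heat (4 * t)) 0 <=
    72 * b ^+ 4 / t0 ^+ 2 * heat 10 0.
  apply: (@le_trans _ _ (72 * (b ^+ 2 / t) ^+ 2 * heat 10 0)).
    by rewrite ler_wpM2l// mulr_ge0// sqr_ge0.
  by rewrite ler_wpM2r// heat_ge0.
by rewrite mulrDr mulrDl mulrDl; exact: F E' IHt.
Qed.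
End replacement.

#[local] Opaque smooth heat.

(** * The two bounds for sums of signs *)

Section list_bounds.
Context {R : realType} (p : R).
Hypothesis p_ge3 : 3 <= p.
Implicit Types (L : seq R) (x y a b t : R).

Lemma heat0E x : heat p 0 x = `|x| `^ p.
Proof. by rewrite heatE sqrtr0 smooth0. Qed.

Lemma heat1E x : heat p 1 x = smooth p 1 x.
Proof. by rewrite heatE sqrtr1. Qed.

Lemma sqr_le_sumsq L a : a \in L -> a ^+ 2 <= sumsq L.
Proof.
elim: L => // b L IH; rewrite inE sumsq_cons => /orP[/eqP->|/IH h].
  by rewrite lerDl sumsq_ge0.
by rewrite (le_trans h)// lerDr sqr_ge0.
Qed.

Lemma radem_norm_powR_le : exists2 k : R, 0 < k & forall L,
  {in L, forall a, 0 <= a} -> sumsq L = 1 ->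
  radem L (fun x => `|x| `^ p) 0 <= smooth p 1 0 - k * \sum_(a <- L) a ^+ 4.
Proof.
have [k k0 hk] := radem_heat_gap p_ge3.
exists (k / 4); first by rewrite divr_gt0.
move=> L L0 L1.
have r2 : 0 < Num.sqrt 2 :> R by rewrite sqrtr_gt0.
have r21 : 1 <= Num.sqrt 2 :> R by rewrite -[leLHS]sqrtr1 ler_sqrt//; lra.
(* The signs that remain after the splitting have variance 1/2, as has the Gaussian part, so the
   full replacement ends at variance 1. Their fourth powers are 4 times smaller, hence [k / 4]. *)
pose L' := [seq a / Num.sqrt 2 | a <- L].
have L'2 : sumsq L' = 2^-1.
  have -> : sumsq L' = sumsq L / 2; last by rewrite L1 mul1r.
  rewrite /sumsq big_map mulr_suml; apply: eq_bigr => a _.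
  by rewrite expr_div_n sqr_sqrtr.
have L'4 : \sum_(a <- L') a ^+ 4 = (\sum_(a <- L) a ^+ 4) / 4.
  rewrite big_map mulr_suml; apply: eq_bigr => a _.
  by rewrite expr_div_n (exprM (Num.sqrt 2) 2 2) sqr_sqrtr// -natrX.
have L'01 : {in L', forall a, 0 <= a <= 1}.
  move=> _ /mapP[a aL ->]; have a0 := L0 a aL.
  rewrite divr_ge0 ?(ltW r2)//= ler_pdivrMr// mul1r.
  apply: le_trans r21; rewrite -ler_sqr ?nnegrE// expr1n -[leRHS]L1.
  exact: sqr_le_sumsq.
have h0 : 4^-1 <= 2^-1 :> R by lra.
have h1 : 2^-1 + sumsq L' <= 1 by rewrite L'2; lra.
have e1 : 2^-1 + sumsq L' = 1 by rewrite L'2; field.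
have := hk L' 2^-1 h0 L'01 h1; rewrite e1 L'4 heat1E => gap.
have e2 : 0 + sumsq L / 2 = 2^-1 by rewrite L1 add0r mul1r.
have := radem_heat_split p_ge3 0 (lexx 0) L0; rewrite e2 -/L' => split_le.
have -> : (fun x => `|x| `^ p) = heat p 0 by apply/funext => x; rewrite heat0E.
have e3 (S : R) : k / 4 * S = k * (S / 4) by ring.
by rewrite e3; exact: le_trans split_le gap.
Qed.

Lemma sumsq_nseq m a : sumsq (nseq m a) = m%:R * a ^+ 2.
Proof. by rewrite /sumsq big_nseq iter_addr_0 mulr_natl. Qed.

(* The n^5 small coefficients are swapped first, starting from an artificial
   variance n^-2; they bring it above 1/2, after which each of the n large
   coefficients costs only O(n^-2). *)
Lemma radem_norm_powR_ge : exists2 K : R, 0 < K & forall n, (2 <= n)%N ->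
  smooth p 1 0 - K / n%:R <=
    radem (nseq n (Num.sqrt (2 * n%:R)^-1) ++ nseq (n ^ 5) (Num.sqrt (2 * (n ^ 5)%:R)^-1))
      (fun x => `|x| `^ p) 0.
Proof.
have p3 := p_ge3.
set M := smooth p 1 0; set M' := heat p 10 0.
have M0 : 0 <= M by exact: smooth_ge0.
have M'0 : 0 <= M' by exact: heat_ge0.
(* Error budget: (M + 2 p M') s for removing the artificial Gaussian of deviation s, and u s for the
   swaps. *)
have Kend (r s x z u : R) : M - x <= r -> r <= M' -> 0 <= s ->
    (1 - 2 * p * s) * r - s * M <= z -> x <= u * s -> M - (M + 2 * p * M' + u) * s <= z.
  move=> h1 h2 s0 h3 h4.
  have : 2 * p * s * r <= 2 * p * s * M' by rewrite ler_wpM2l// !mulr_ge0//; lra.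
  move: h1 h2 h3 h4; clear; lra.
have Kmid (W X Y r e1 e2 : R) : Y - e1 <= r -> X - e2 <= Y -> W <= X ->
  W - (e1 + e2) <= r by lra.
have K0 : 0 < M + 2 * p * M' + 144 * M' + 1.
  have pM : 0 <= p * M' by rewrite mulr_ge0//; lra.
  by move: pM M0 M'0; clear; lra.
exists (M + 2 * p * M' + 144 * M' + 1).
  exact: K0.
move=> n n2.
set b := Num.sqrt (2 * n%:R)^-1; set a := Num.sqrt _.
pose N := n%:R : R.
have N2 : 2 <= N by rewrite ler_nat.
rewrite -/N in b *.
have n5 : (n ^ 5)%:R = N ^+ 5 by rewrite natrX.
have N0 : 0 < N by lra.
have N5 : 0 < N ^+ 5 by rewrite exprn_gt0.
have b2 : b ^+ 2 = (2 * N)^-1 by rewrite sqr_sqrtr// invr_ge0; lra.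
have a2 : a ^+ 2 = (2 * N ^+ 5)^-1 by rewrite sqr_sqrtr n5// invr_ge0; lra.
have b0 : 0 <= b by exact: sqrtr_ge0.
have a0 : 0 <= a by exact: sqrtr_ge0.
have N0' : N != 0 by rewrite gt_eqF.
set A := nseq (n ^ 5) a; set B := nseq n b.
have sA : sumsq A = 2^-1 by rewrite sumsq_nseq a2 n5; field.
have sB : sumsq B = 2^-1 by rewrite sumsq_nseq b2 -/N; field.
have qA : \sum_(c <- A) c ^+ 4 = (4 * N ^+ 5)^-1.
  rewrite big_nseq iter_addr_0 -[LHS]mulr_natl n5 (exprM a 2 2) a2.
  by field.
have qB : \sum_(c <- B) c ^+ 4 = (4 * N)^-1.
  rewrite big_nseq iter_addr_0 -[LHS]mulr_natl -/N (exprM b 2 2) b2.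
  by field.
set s := N^-1.
have s0 : 0 < s by rewrite invr_gt0.
have s2 : s <= 2^-1 by rewrite lef_pV2 ?posrE.
have ss0 : 0 < s ^+ 2 by rewrite exprn_gt0.
have ss : s ^+ 2 <= 4^-1.
  have e : 4^-1 = (2^-1 : R) ^+ 2 by field.
  by rewrite e ler_sqr// nnegrE ltW.
have posAB : {in A ++ B, forall c, 0 <= c}.
  by move=> c; rewrite mem_cat !mem_nseq => /orP[] /andP[_ /eqP->].
have posB : {in B ++ [::], forall c, 0 <= c}.
  by move=> c; rewrite cats0 => cB; apply: posAB; rewrite mem_cat cB orbT.
have smallA : {in A, forall c, c ^+ 2 <= s ^+ 2 / 2}.
  move=> c; rewrite mem_nseq => /andP[_ /eqP->]; rewrite a2.
  have -> : s ^+ 2 / 2 = (2 * N ^+ 2)^-1 by rewrite /s; field.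
  rewrite lef_pV2 ?posrE; [|lra|by rewrite mulr_gt0// exprn_gt0].
  rewrite ler_pM2l//; apply: ler_weXn2l => //; lra.
have smallB : {in B, forall c, c ^+ 2 <= (2^-1 : R) / 2}.
  move=> c; rewrite mem_nseq => /andP[_ /eqP->]; rewrite b2.
  have -> : (2^-1 : R) / 2 = (2 * 2)^-1 by field.
  by rewrite lef_pV2 ?posrE; lra.
have tA : s ^+ 2 + sumsq A + sumsq B <= 2 by rewrite sA sB; lra.
have tB : s ^+ 2 + sumsq A + sumsq B + sumsq ([::] : seq R) <= 2.
  by rewrite sA sB /sumsq big_nil; lra.
have h2 : 0 < 2^-1 :> R by [].
have h2' : 2^-1 <= s ^+ 2 + sumsq A by rewrite sA; lra.
have u0 : 0 <= s ^+ 2 by exact: ltW.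
have u1 : 0 <= s ^+ 2 + sumsq (A ++ B) by rewrite addr_ge0// sumsq_ge0.
have u2 : s ^+ 2 + sumsq (A ++ B) <= 10 by rewrite sumsq_cat sA sB; lra.
have v1 : 1 <= s ^+ 2 + sumsq A + sumsq B by rewrite sA sB; lra.
(* First pass over the small coefficients with floor s^2, then over the large ones with floor
   1/2. *)
have g1 := radem_heat_ge p_ge3 ss0 (lexx _) posAB smallA tA.
have g2 := radem_heat_ge p_ge3 h2 h2' posB smallB tB.
rewrite /= cats0 qB in g2; rewrite qA in g1.
have g3 := le_trans (radem_heat_le p_ge3 0 u0 posAB) (heat0_ndecr p_ge3 u1 u2).
have g4 := heat0_ndecr p_ge3 ler01 v1.
rewrite heat1E in g4.
have s02 : 0 < s <= 2^-1 by rewrite s0.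
have sE : Num.sqrt (s ^+ 2) = s by rewrite sqrtr_sqr gtr0_norm.
have step y : (1 - 2 * p * s) * heat p (s ^+ 2) y - s * M <= `|y| `^ p.
  by rewrite heatE sE; exact: smooth_small_le.
have := le_radem (A ++ B) 0 step; rewrite rademBc (radem_catC A B (fun x : R => `|x| `^ p)) => g5.
(* The low floor costs the first pass a factor N^4, which the fourth powers of size 1 / (4 N^5)
   compensate up to 1 / N. *)
have err : 72 / (4 * N ^+ 5) / (s ^+ 2) ^+ 2 * M' + 72 / (4 * N) / 2^-1 ^+ 2 * M' =
    (18 + 72) * M' * s.
  by rewrite /s; field.
set r := radem (A ++ B) (heat p (s ^+ 2)) 0 in g1 g3 g5.
set X := heat p (s ^+ 2 + sumsq A + sumsq B) 0 in g2 g4.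
have rM : M - (72 / (4 * N ^+ 5) / (s ^+ 2) ^+ 2 * M' + 72 / (4 * N) / 2^-1 ^+ 2 * M') <= r.
  exact: Kmid g1 g2 g4.
have ns : 0 <= s by exact: ltW.
have e1 : (18 + 72) * M' * s <= (144 * M' + 1) * s.
  by rewrite ler_wpM2r//; move: M'0; clear; lra.
rewrite -err in e1.
have := Kend _ _ _ _ _ rM g3 ns g5 e1.
by rewrite !addrA.
Qed.
End list_bounds.

(** * Rademacher variables on a probability space *)

Section expectation_of_rademacher_sums.
Context {R : realType} d (T : measurableType d) (P : probability T R).
Context (n : nat) (eps : 'I_n -> {RV P >-> R}) (a : 'I_n -> R).
Hypothesis iid : iid_rademacher eps.
Variable h : R -> R.
Hypothesis mh : measurable_fun [set: R] h.
Hypothesis h0 : forall x, 0 <= h x.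
Local Open Scope ereal_scope.

Definition cylinder (J : {set 'I_n}) (sg : 'I_n -> R) : set T :=
  \bigcap_(j in [set` J]) (eps j @^-1` [set sg j]).

Lemma measurable_preimage_eps i (A : set R) : measurable A -> measurable (eps i @^-1` A).
Proof. by move=> mA; exact: measurable_funPTI. Qed.

Lemma measurable_cylinder J sg : measurable (cylinder J sg).
Proof.
apply: fin_bigcap_measurable; first exact: finite_finset.
by move=> i _; apply: measurable_preimage_eps; exact: measurable_set1.
Qed.

Lemma probability_cylinder (J : {set 'I_n}) (sg : 'I_n -> R) :
  {in J, forall j, sg j = 1%R \/ sg j = (-1)%R} ->
  P (cylinder J sg) = (2^-1 ^+ #|J|)%:E.
Proof.
move=> sgJ; have [ind rad] := iid.
rewrite /cylinder ind; last by move=> i; exact: measurable_set1.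
rewrite (eq_bigr (fun=> (2^-1 : R)%:E)); last first.
  by move=> j jJ; have [h1 hN1] := rad j; case: (sgJ j jJ) => ->.
have -> : \prod_(i in J) (2^-1 : R)%:E = (\prod_(i in J) (2^-1 : R))%:E.
  by apply/esym; exact: (big_morph EFin EFinM).
by rewrite prodr_const.
Qed.

Let sumof (s : seq 'I_n) w : R := (\sum_(i <- s) a i * eps i w)%R.

Let measurable_sumof x s : measurable_fun [set: T] (fun w => (h (x + sumof s w))%:E).
Proof.
apply/measurable_EFinP; apply: (measurableT_comp mh).
apply: measurable_funD => //.
apply: measurable_sum => i; exact: measurable_funM.
Qed.

(** The set [J] records the signs already fixed. Fixing the next one splits the cylinder in two,
    just as [radem] branches on its head; independence enters through the probability of the
    cylinders. *)
Lemma integral_cylinder (s : seq 'I_n) (J : {set 'I_n}) (sg : 'I_n -> R) x :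
  uniq s -> {in s, forall i, i \notin J} ->
  {in J, forall j, sg j = 1%R \/ sg j = (-1)%R} ->
  \int[P]_(w in cylinder J sg) (h (x + sumof s w))%:E =
  (2^-1 ^+ #|J| * radem [seq a i | i <- s] h x)%:E.
Proof.
elim: s J sg x => [|i s IH] J sg x.
  move=> _ _ sgJ; rewrite /sumof; under eq_integral do rewrite big_nil addr0.
  rewrite integral_cst; last exact: measurable_cylinder.
  transitivity ((h x)%:E * (2^-1 ^+ #|J|)%:E).
    by congr (_ * _); exact: probability_cylinder.
  by rewrite /= -EFinM mulrC.
move=> /= /andP[is_ us] sJ sgJ.
have iJ : i \notin J by apply: sJ; rewrite mem_head.
pose sg' (v : R) := fun j => if j == i then v else sg j.
pose J' := i |: J.
have sJ' : {in s, forall k, k \notin J'}.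
  move=> k ks; rewrite !inE negb_or; apply/andP; split.
    by apply: contraNN is_ => /eqP <-.
  by apply: sJ; rewrite inE ks orbT.
have sgJ' v : v = 1%R \/ v = (-1)%R ->
    {in J', forall j, sg' v j = 1%R \/ sg' v j = (-1)%R}.
  move=> v1 j; rewrite !inE /sg'; case: (eqVneq j i) => //= _ jJ; exact: sgJ.
have cylE v : cylinder J' (sg' v) = cylinder J sg `&` (eps i @^-1` [set v]).
  apply/seteqP; split => [w cw|w [cw wi] j /= ].
    split.
      move=> j /= jJ; have := cw j; rewrite /= !inE jJ orbT /sg' => /(_ isT).
      by case: (eqVneq j i) jJ => // ->; rewrite (negbTE iJ).
    by have := cw i; rewrite /= !inE eqxx /sg' eqxx; exact.
  rewrite !inE /sg' => /orP[/eqP->|jJ]; first by rewrite eqxx.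
  case: (eqVneq j i) jJ => [->|_ jJ]; first by rewrite (negbTE iJ).
  exact: cw.
have J'card : #|J'| = #|J|.+1 by rewrite cardsU1 iJ.
(* [rademacher] leaves [eps i] free on a null set, which is discarded before the cylinder is
   split. *)
pose N : set T := ~` ((eps i @^-1` [set 1%R]) `|` (eps i @^-1` [set (-1)%R])).
have m1 := measurable_preimage_eps i (measurable_set1 (1 : R)%R).
have mN1 := measurable_preimage_eps i (measurable_set1 (-1 : R)%R).
have mN : measurable N by apply: measurableC; exact: measurableU.
have PN : P N = 0.
  have [_ rad] := iid; have [h1 hN1] := rad i.
  rewrite probability_setC; last exact: measurableU.
  have -> : P ((eps i @^-1` [set 1%R]) `|` (eps i @^-1` [set (-1)%R])) =
      (2^-1 : R)%:E + (2^-1 : R)%:E.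
    rewrite measureU//; last first.
      apply/seteqP; split => // w [/= -> /eqP]; rewrite -subr_eq0 opprK.
      by rewrite -mulr2n pnatr_eq0.
    by congr (_ + _); [exact: h1|exact: hN1].
  have e : (2^-1 + 2^-1 = 1 :> R)%R by field.
  by rewrite -EFinD e subrr.
have -> : \int[P]_(w in cylinder J sg) (h (x + sumof (i :: s) w))%:E =
    \int[P]_(w in cylinder J sg `\` N) (h (x + sumof (i :: s) w))%:E.
  apply: ge0_negligible_integral => //.
  - exact: measurable_cylinder.
  - by apply: measurable_funTS; exact: measurable_sumof.
  - by move=> w _; rewrite lee_fin.
have -> : cylinder J sg `\` N = cylinder J' (sg' 1%R) `|` cylinder J' (sg' (-1)%R).
  rewrite !cylE -setIUr; apply/seteqP; split => w [cw].
    by rewrite /N /= => /contrapT.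
  by move=> wi; split => //; apply.
rewrite ge0_integral_setU; first last.
- apply/disj_setPS => w [/=]; rewrite !cylE => -[_ /= ->] [_ /eqP].
  by rewrite -subr_eq0 opprK -mulr2n pnatr_eq0.
- by move=> w _; rewrite lee_fin.
- by apply: measurable_funTS; exact: measurable_sumof.
- exact: measurable_cylinder.
- exact: measurable_cylinder.
have part v : v = 1%R \/ v = (-1)%R ->
    \int[P]_(w in cylinder J' (sg' v)) (h (x + sumof (i :: s) w))%:E =
    (2^-1 ^+ #|J|.+1 * radem [seq a k | k <- s] h (x + a i * v))%:E.
  move=> v1; rewrite -J'card -(IH J' (sg' v) (x + a i * v)%R us sJ' (sgJ' v v1)).
  apply: eq_integral => w; rewrite inE cylE => -[_ /= wi].
  by rewrite /sumof big_cons wi addrA.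
rewrite (part 1%R); last by left.
rewrite (part (-1)%R); last by right.
by rewrite -EFinD mulr1 mulrN1 exprS; congr _%:E; field.
Qed.

Lemma expectation_radem :
  'E_P[(fun w => h (\sum_(i < n) a i * eps i w)%R)] =
  (radem [seq a i | i <- enum 'I_n] h 0)%:E.
Proof.
have := @integral_cylinder (enum 'I_n) finset.set0 (fun=> 1%R) 0%R (enum_uniq _).
rewrite cards0 expr0 mul1r => <-; first last.
- by move=> j; rewrite inE.
- by move=> i; rewrite inE.
rewrite unlock; have -> : cylinder finset.set0 (fun=> 1%R) = [set: T].
  by apply/seteqP; split => // w _ j /=; rewrite inE.
apply: eq_integral => w _.
by rewrite add0r /sumof big_enum.
Qed.
End expectation_of_rademacher_sums.

(** * A probability space carrying n independent signs and a Gaussian *)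

Section coin_space.
Context (R : realType) (n : nat).
Implicit Types (J : {set 'I_n}) (A : 'I_n -> set R).

Local Notation cube := {ffun 'I_n -> bool}.

Let cubeV_ge0 : (0 : R) <= #|cube|%:R^-1. Proof. by rewrite invr_ge0. Qed.

(** The uniform law on sign patterns, coded by the integers below [#|cube|] so that every set is
    measurable. *)
Definition coin_measure : set nat -> \bar R :=
  msum (fun k => mscale (NngNum cubeV_ge0) \d_k) #|cube|.

HB.instance Definition _ := Measure.on coin_measure.

(** The default pattern is reached only from integers of mass 0. *)
Definition coin_bits (k : nat) : cube := nth [ffun=> true] (enum cube) k.

Definition bool_sign (b : bool) : R := if b then 1 else -1.

Lemma coin_measureE (B : set nat) (F : cube -> bool) :
  (forall k, B k <-> F (coin_bits k)) ->
  coin_measure B = (#|cube|%:R^-1 * \sum_(s : cube) (F s)%:R)%:E.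
Proof.
move=> BF; rewrite /coin_measure /msum/=.
rewrite -[in RHS]big_enum [in RHS](big_nth [ffun=> true]) -cardE big_mkord mulr_sumr -sumEFin.
apply: eq_bigr => k _; rewrite /mscale/= diracE -EFinM; congr (_ * _%:R)%:E.
congr nat_of_bool; apply/idP/idP; rewrite -/(coin_bits k).
  by rewrite inE => /BF.
by rewrite inE => /BF.
Qed.

Lemma coin_measure_setT : coin_measure [set: nat] = 1%E.
Proof.
rewrite (@coin_measureE _ (fun=> true))// sumr_const cardT -cardE mulVf//.
by rewrite pnatr_eq0 card_ffun card_bool expn_eq0.
Qed.

HB.instance Definition _ :=
  @Measure_isProbability.Build _ _ R coin_measure coin_measure_setT.

Lemma coin_measure_bigcap J A :
  coin_measure (\bigcap_(j in [set` J]) [set k | A j (bool_sign (coin_bits k j))]) =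
  (\prod_(j in J) (2^-1 * \sum_(b : bool) (bool_sign b \in A j)%:R))%:E.
Proof.
rewrite (@coin_measureE _ (fun s => [forall j in J, bool_sign (s j) \in A j])); last first.
  move=> k; split => [H|/forall_inP H j jJ].
    by apply/forall_inP => j jJ; rewrite inE; exact: H.
  by have := H j jJ; rewrite inE.
congr _%:E.
(* The indicator becomes a product over all coordinates, so that summing over patterns factorises; a
   coordinate outside [J] contributes 2 values times the weight 1/2. *)
pose c j b : R := if j \in J then (bool_sign b \in A j)%:R else 1.
rewrite (eq_bigr (fun s : cube => \prod_j c j (s j))); last first.
  move=> s _; rewrite /c -big_mkcond /=.
  case: (boolP [forall j in J, _]) => [/forall_inP H|].
    by rewrite big1// => j jJ; rewrite H.
  rewrite negb_forall_in => /exists_inP[j jJ sj].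
  by rewrite (bigD1 j)//= (negbTE sj) mul0r.
rewrite -(bigA_distr_bigA c) card_ffun card_bool card_ord natrX -exprVn.
rewrite -[X in _ ^+ X](card_ord n) -prodr_const -big_split/= [RHS]big_mkcond/=.
apply: eq_bigr => j _; rewrite /c; case: ifP => // _.
by rewrite sumr_const card_bool mulVf.
Qed.

Local Notation gauss := (@normal_prob R 0 1).

(** [khinchine_deficit] speaks of signs and [G] on one space, hence the product. *)
Definition coin_gauss_prob : probability (measurableTypeR R * nat)%type R :=
  (gauss \x coin_measure)%E.

Let eps_fun i (w : measurableTypeR R * nat) : R :=
  bool_sign (coin_bits w.2 i).

Let measurable_eps_fun i : measurable_fun [set: measurableTypeR R * nat] (eps_fun i).
Proof.
have m : measurable_fun [set: nat]
  (fun k => bool_sign (coin_bits k i)) by [].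
exact: (measurableT_comp m measurable_snd).
Qed.

Definition coin_eps i : {RV coin_gauss_prob >-> R} :=
  HB.pack (eps_fun i) (isMeasurableFun.Build _ _ _ _ _ (measurable_eps_fun i)).

Let gauss_fun (w : measurableTypeR R * nat) : R := w.1.

Let measurable_gauss_fun : measurable_fun [set: measurableTypeR R * nat] gauss_fun.
Proof. exact: measurable_fst. Qed.

Definition coin_gauss : {RV coin_gauss_prob >-> R} :=
  HB.pack gauss_fun (isMeasurableFun.Build _ _ _ _ _ measurable_gauss_fun).

Lemma coin_gauss_standard : standard_gaussian coin_gauss.
Proof.
move=> A mA; rewrite /distribution /pushforward/=.
have -> : coin_gauss @^-1` A = A `*` [set: nat].
  by apply/seteqP; split => w //= [].
rewrite /coin_gauss_prob/= product_measure1E//.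
rewrite -[RHS]mule1; congr (_ * _)%E; exact: coin_measure_setT.
Qed.

Lemma coin_eps_bigcap J A :
  coin_gauss_prob (\bigcap_(j in [set` J]) (coin_eps j @^-1` A j)) =
  (\prod_(j in J) (2^-1 * \sum_(b : bool) (bool_sign b \in A j)%:R))%:E.
Proof.
rewrite -coin_measure_bigcap.
have -> : \bigcap_(j in [set` J]) (coin_eps j @^-1` A j) =
  [set: measurableTypeR R] `*` (\bigcap_(j in [set` J]) [set k | A j (bool_sign (coin_bits k j))]).
  by apply/seteqP; split => w //= [].
rewrite /coin_gauss_prob/= product_measure1E//.
by rewrite -[RHS]mul1e; congr (_ * _)%E; exact: (probability_setT gauss).
Qed.

Lemma coin_eps_preimage i (B : set R) :
  coin_gauss_prob (coin_eps i @^-1` B) =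
  (2^-1 * \sum_(b : bool) (bool_sign b \in B)%:R)%:E.
Proof.
have := @coin_eps_bigcap [set i]%SET (fun=> B); rewrite big_set1 => <-.
congr (_ _); apply/seteqP; split => [w wB j /=|w].
  by rewrite inE => /eqP ->.
by apply; rewrite /= inE.
Qed.

Lemma coin_eps_iid : iid_rademacher coin_eps.
Proof.
split=> [J A mA|i].
  rewrite coin_eps_bigcap (eq_bigr (fun j =>
    (2^-1 * \sum_(b : bool) (bool_sign b \in A j)%:R)%:E)); last first.
    by move=> j _; exact: coin_eps_preimage.
  by apply: (big_morph EFin EFinM).
have ne : (1 : R) != -1 by rewrite -subr_eq0 opprK -mulr2n pnatr_eq0.
have inb (u v : R) : (u \in [set v]) = (u == v) by apply/idP/eqP; rewrite inE.
split; rewrite coin_eps_preimage big_bool /bool_sign !inb.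
  by rewrite eqxx eq_sym (negbTE ne) /= mulr0n addr0 mulr1.
by rewrite eqxx (negbTE ne) /= mulr0n add0r mulr1.
Qed.
End coin_space.

#[local] Opaque smooth heat.

(** * The exponent 4 is attained, and no smaller one is possible *)

Section main.
Context {R : realType} (p : R).
Hypothesis p_ge3 : 3 <= p.

Let measurable_absp : measurable_fun [set: R] (fun x : R => `|x| `^ p).
Proof. by apply/measurable_EFinP; exact: measurable_norm_powR. Qed.

Lemma expectation_standard_gaussian d (T : measurableType d) (P : probability T R)
    (G : {RV P >-> R}) : standard_gaussian G ->
  ('E_P[(fun w => (`|G w| `^ p)%R)] = (smooth p 1 0)%:E)%E.
Proof.
move=> stdG; rewrite (smooth_EFin p_ge3) unlock.
transitivity (\int[distribution P G]_y (`|y| `^ p)%:E)%E.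
  apply/esym; apply: eq_trans (ge0_integral_distribution G _ _) _.
  - by apply/measurable_EFinP; exact: measurable_absp.
  - by move=> y; rewrite lee_fin powR_ge0.
  - by [].
(* The image under the identity moves [normal_prob] from [measurableTypeR R] to [R], where the law
   of [G] lives. *)
have mid : measurable_fun [set: measurableTypeR R] (idfun : measurableTypeR R -> R).
  by move=> _ A mA; rewrite setTI.
have mf : measurable_fun [set: R] (fun y : R => (`|y| `^ p)%:E).
  by apply/measurable_EFinP; exact: measurable_absp.
have f0 : {in [set: R], forall y : R, (0 <= (`|y| `^ p)%:E)%E}.
  by move=> y _; rewrite lee_fin powR_ge0.
transitivity (\int[pushforward (@normal_prob R 0 1) (idfun : measurableTypeR R -> R)]_y
    (`|y| `^ p)%:E)%E.
  by apply: eq_measure_integral => A mA _; exact: stdG.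
apply: eq_trans (ge0_integral_pushforward mid (@normal_prob R 0 1) measurableT mf f0) _.
by apply: eq_integral => y _; rewrite /= add0r mul1r.
Qed.

Lemma map_enum_sum (n : nat) (a : 'I_n -> R) (F : R -> R) :
  \sum_(x <- [seq a i | i <- enum 'I_n]) F x = \sum_(i < n) F (a i).
Proof. by rewrite big_map big_enum. Qed.

Lemma khinchine_deficit4 : khinchine_deficit p (4 : R).
Proof.
have [C C0 hC] := radem_norm_powR_le p_ge3.
exists C => // n a _ _ a0 a1 d T P eps G iid stdG.
rewrite (expectation_radem a iid measurable_absp) ?(expectation_standard_gaussian stdG);
  last by move=> x; rewrite powR_ge0.
rewrite -EFinB lee_fin.
have -> : \sum_(i < n) a i `^ 4 = \sum_(x <- [seq a i | i <- enum 'I_n]) x ^+ 4.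
  by rewrite map_enum_sum; apply: eq_bigr => i _; rewrite powR_mulrn.
apply: hC; last by rewrite /sumsq map_enum_sum.
by move=> _ /mapP[i _ ->].
Qed.

(** The hypothesis quantifies over all probability spaces; it is brought to bear on lists by
    evaluating it on the coin space. *)
Lemma radem_le_of_khinchine_deficit q : khinchine_deficit p q ->
  exists2 C : R, 0 < C & forall L : seq R, (0 < size L)%N ->
    sorted (fun x y => y <= x) L -> {in L, forall a, 0 <= a} -> sumsq L = 1 ->
    radem L (fun x => `|x| `^ p) 0 <= smooth p 1 0 - C * \sum_(a <- L) a `^ q.
Proof.
move=> [C C0 hC]; exists C => // L L0 srt pos sum1.
pose n := size L; pose a (i : 'I_n) := nth 0 L i.
have aL : [seq a i | i <- enum 'I_n] = L.
  rewrite -[RHS](mkseq_nth 0) /mkseq -val_enum_ord -map_comp.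
  exact: eq_map.
have := hC n a L0 _ _ _ _ _ (coin_gauss_prob R n) (coin_eps R (n := n)) (coin_gauss R n).
rewrite (expectation_radem a (coin_eps_iid R n) measurable_absp); last first.
  by move=> x; rewrite powR_ge0.
rewrite (expectation_standard_gaussian (@coin_gauss_standard R n)) -EFinB lee_fin aL.
rewrite -(map_enum_sum a (fun x => x `^ q)) -(map_enum_sum a (fun x => x ^+ 2)) aL.
apply => //; last 2 first.
- exact: coin_eps_iid.
- exact: coin_gauss_standard.
- move=> i j ij.
  have tr : transitive (fun x y : R => y <= x).
    by move=> y x z /= yx zy; exact: le_trans zy yx.
  have rf : reflexive (fun x y : R => y <= x) by move=> x /=.
  by apply: (sorted_leq_nth tr rf 0 srt); rewrite ?inE.
- by move=> i; apply: pos; exact: mem_nth.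
Qed.

Lemma khinchine_deficit_ge4 q : khinchine_deficit p q -> 0 < q -> 4 <= q.
Proof.
move=> /radem_le_of_khinchine_deficit[C C0 hC] q0.
have [K K0 hK] := radem_norm_powR_ge p_ge3.
rewrite leNgt; apply/negP => q4.
(* Comparing both bounds gives C n (2 n)^(-q/2) <= K / n, that is n^e <= X for every n >= 2, which
   is impossible for large n once e > 0. *)
pose e : R := 2 - q / 2; have e0 : 0 < e by rewrite /e; lra.
pose X := 2 `^ (q / 2) * K / C; have X0 : 0 < X.
  by rewrite /X divr_gt0// mulr_gt0// powR_gt0.
have [n n2 hn] : exists2 n : nat, (2 <= n)%N & X `^ e^-1 < n%:R.
  exists (Num.bound (X `^ e^-1)).+2 => //.
  by apply: (lt_trans (archi_boundP (powR_ge0 _ _))); rewrite ltr_nat.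
set N := n%:R : R.
have N2 : 2 <= N by rewrite ler_nat.
have N0 : 0 < N by lra.
have XN : X < N `^ e.
  have -> : X = (X `^ e^-1) `^ e by rewrite -powRrM mulVf ?gt_eqF// powRr1// ltW.
  by apply: gt0_ltr_powR => //; rewrite nnegrE ?powR_ge0// ltW.
pose b : R := Num.sqrt (2 * N)^-1; pose a : R := Num.sqrt (2 * (n ^ 5)%:R)^-1.
pose L := nseq n b ++ nseq (n ^ 5) a.
have b0 : 0 <= b by exact: sqrtr_ge0.
have a0 : 0 <= a by exact: sqrtr_ge0.
have n5 : (0 < (n ^ 5)%:R :> R) by rewrite ltr0n expn_gt0 (ltnW n2).
have ab : a <= b.
  rewrite /a /b ler_sqrt ?invr_ge0; last by lra.
  rewrite lef_pV2 ?posrE; [|lra|lra].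
  by rewrite ler_pM2l// /N ler_nat -{1}(expn1 n) leq_exp2l.
have posL : {in L, forall c, 0 <= c}.
  by move=> c; rewrite mem_cat !mem_nseq => /orP[] /andP[_ /eqP->].
have srt : sorted (fun x y => y <= x) L.
  rewrite sorted_pairwise; last by move=> y x z /= yx zy; exact: le_trans zy yx.
  rewrite /L pairwise_cat; apply/and3P; split.
  - by apply/allrelP => x y; rewrite !mem_nseq => /andP[_ /eqP->] /andP[_ /eqP->].
  - by apply/(pairwiseP 0) => i j; rewrite !inE size_nseq => hi hj _; rewrite !nth_nseq hi hj.
  - by apply/(pairwiseP 0) => i j; rewrite !inE size_nseq => hi hj _; rewrite !nth_nseq hi hj.
have sum1 : sumsq L = 1.
  rewrite sumsq_cat !sumsq_nseq !sqr_sqrtr ?invr_ge0; [|lra|lra].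
  by rewrite -/N; field; rewrite !gt_eqF.
have sizeL : (0 < size L)%N by rewrite size_cat size_nseq addn_gt0 (ltnW n2).
have up := hC L sizeL srt posL sum1.
have low := hK n n2; rewrite -/N -/a -/b -/L in low.
(* Only the large coefficients are kept in the lower bound of the deficit. *)
have bq : N * b `^ q <= \sum_(c <- L) c `^ q.
  rewrite big_cat/= [X in _ <= X + _]big_nseq iter_addr_0 -[X in _ <= X + _]mulr_natl -/N lerDl.
  by apply: sumr_ge0 => c _; exact: powR_ge0.
have key : C * (N * b `^ q) <= K / N.
  have h : C * (N * b `^ q) <= C * \sum_(c <- L) c `^ q by rewrite ler_pM2l.
  have F (u v w r : R) : u - w <= r -> r <= u - v -> v <= w.
    by move=> h1 h2; have := le_trans h1 h2; rewrite lerD2l lerN2.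
  exact: le_trans h (F _ _ _ _ low up).
have bE : b `^ q = (2 `^ (q / 2))^-1 * (N `^ (q / 2))^-1.
  rewrite /b -powR12_sqrt ?invr_ge0; last by lra.
  rewrite -powR_inv1; last by lra.
  rewrite -!powRrM -invfM -(powRM _ (ler0n R 2) (ltW N0)) -powRN.
  by congr (_ `^ _); field.
have NE : N `^ e * N `^ (q / 2) = N ^+ 2.
  rewrite -powRD; last by rewrite (gt_eqF N0) implybT.
  by rewrite (_ : e + q / 2 = 2); [rewrite powR_mulrn// ltW|rewrite /e; ring].
move: XN; rewrite ltNge => /negP; apply.
have P2 : 0 < 2 `^ (q / 2) :> R by exact: powR_gt0.
have PN : 0 < N `^ (q / 2) by exact: powR_gt0.
rewrite /X ler_pdivlMr// -(ler_pM2r PN).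
have -> : N `^ e * C * N `^ (q / 2) = C * N ^+ 2 by rewrite -NE; ring.
move: key; rewrite bE ler_pdivlMr//.
move: P2 PN; set A := 2 `^ _; set B := N `^ (q / 2) => A0 B0 key.
have -> : C * N ^+ 2 = C * (N * (A^-1 * B^-1)) * N * (A * B) by field; rewrite !gt_eqF.
have -> : A * K * B = K * (A * B) by ring.
by rewrite ler_pM2r// mulr_gt0.
Qed.
End main.

Theorem mainTheorem4 (R : realType) (p : R) (hp : 3 <= p) :
  let admissible : set R := [set q : R | 0 < q /\ khinchine_deficit p q] in
  admissible 4 /\ lbound admissible 4.
Proof.
move=> admissible; split; first by split => //; exact: khinchine_deficit4.
by move=> q [q0 hq]; exact: khinchine_deficit_ge4 hq q0.
Qed.
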